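(* Let $k,j$ be positive integers with $j\le k$, and fix $p$ with $p_c<p<1$. Given $n\in\mathbb{Z}_+$ and a vertex $r\in\mathbb{T}^k$, denote by $\mathbb{T}$ either the ball in $\mathbb{T}^k$ of radius $n$ and center $r$ (in the unoriented case) or the finite rooted tree consisting of the first $n$ levels of $\bar{\mathbb{T}}^k$ (in the oriented case). Then there exists $c>0$ (independent of $n$) such that, for every $n\in\mathbb{Z}_+$, $$e^{-cn}\le\operatorname{gap}(\mathcal{L}_{\mathbb{T}})\le e^{-n/c}\quad\text{(unoriented case)},$$ $$e^{-cn}\le\operatorname{gap}(\bar{\mathcal{L}}_{\mathbb{T}})\le e^{-n/c}\quad\text{(oriented case)}.$$
   Context: $\mathbb{T}^k$ is the infinite regular unrooted tree in which every vertex has exactly $k+1$ neighbors. $\bar{\mathbb{T}}^k$ is the infinite rooted $k$-ary tree: the root has $k$ children (and no ancestor), and every other vertex has $k$ children and one ancestor (parent). For a vertex $x$, $\mathcal{N}_x$ is the set of its neighbors and, in the rooted case, $\mathcal{K}_x$ is the set of its children. Let $V$ be the vertex set of the tree under consideration, $\Omega=\{0,1\}^V$ (value $1$ = occupied, $0$ = empty). For $p\in[0,1]$ let $\mu=\bigotimes_{x\in V}\mu_x$ be the product measure with $\mu_x(1)=p$, $\mu_x(0)=q=1-p$. $\mu_x(f)(\omega)$ denotes the average of $f$ over the variable at $x$ with respect to $\mu_x$, the other variables being fixed equal to those of $\omega$. The FA-jf model on $\mathbb{T}^k$ and the OFA-jf model on $\bar{\mathbb{T}}^k$ at density $p$ are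 the continuous time Markov processes reversible with respect to $\mu$ whose generators act on local functions (functions of finitely many variables) as $$\mathcal{L}f(\omega)=\sum_{x\in\mathbb{T}^k}c_x(\omega)[\mu_x(f)(\omega)-f(\omega)],\qquad \bar{\mathcal{L}}f(\omega)=\sum_{x\in\bar{\mathbb{T}}^k}\bar c_x(\omega)[\mu_x(f)(\omega)-f(\omega)],$$ where $c_x(\omega)=1$ if $\sum_{y\in\mathcal{N}_x}(1-\omega_y)\ge j$ and $0$ otherwise, and $\bar c_x(\omega)=1$ if $\sum_{y\in\mathcal{K}_x}(1-\omega_y)\ge j$ and $0$ otherwise; they extend to non-positive self-adjoint operators on $L^2(\Omega,\mu)$. The critical densities are $p_c=\sup\{p\in[0,1): 0\text{ is a simple eigenvalue of }\mathcal{L}\}$ and $\bar p_c=\sup\{p\in[0,1): 0\text{ is a simple eigenvalue of }\bar{\mathcal{L}}\}$; for given $k,j$ they coincide, $p_c=\bar p_c$. Finite models: for a finite subtree $\mathbb{T}$ of $\mathbb{T}^k$ or $\bar{\mathbb{T}}^k$, let $\Omega_{\mathbb{T}}=\{0,1\}^{\mathbb{T}}$ and $\mu_{\mathbb{T}}=\bigotimes_{x\in\mathbb{T}}\mu_x$. For $\eta\in\Omega_{\mathbb{T}}$ let $\eta^0\in\Omega$ be the extension of $\eta$ equal to $0$ outside $\mathbb{T}$, and set $c_{\mathbb{T},x}(\eta)=c_x(\eta^0)$, $\bar c_{\mathbb{T},x}(\eta)=\bar c_x(\eta^0)$ for $x\in\mathbb{T}$. The generators of the FA-jf and OFA-jf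 models on $\mathbb{T}$ are $$\mathcal{L}_{\mathbb{T}}f(\eta)=\sum_{x\in\mathbb{T}}c_{\mathbb{T},x}(\eta)[\mu_x(f)(\eta)-f(\eta)],\qquad \bar{\mathcal{L}}_{\mathbb{T}}f(\eta)=\sum_{x\in\mathbb{T}}\bar c_{\mathbb{T},x}(\eta)[\mu_x(f)(\eta)-f(\eta)].$$ The spectral gap is $\operatorname{gap}(\mathcal{L}_{\mathbb{T}})=\inf_{f\neq\mathrm{const}}\mu_{\mathbb{T}}(f(-\mathcal{L}_{\mathbb{T}}f))/\operatorname{Var}_{\mathbb{T}}(f)$, where $f:\Omega_{\mathbb{T}}\to\mathbb{R}$ and $\operatorname{Var}_{\mathbb{T}}(f)$ is the variance of $f$ under $\mu_{\mathbb{T}}$; analogously for $\bar{\mathcal{L}}_{\mathbb{T}}$. *)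

(* Defs.v *)
From HB Require Import structures.
From mathcomp Require Import all_boot all_order all_algebra finmap.
From mathcomp Require Import all_classical all_reals all_analysis.
From mathcomp Require Import measurable_realfun zify lra ring.

Set Implicit Arguments.
Unset Strict Implicit.
Unset Printing Implicit Defensive.

Import Order.TTheory GRing.Theory Num.Theory.
Import numFieldNormedType.Exports.

Local Open Scope classical_set_scope.
Local Open Scope ring_scope.

(* In a configuration [true] is the value 1 (occupied) and [false] the value 0
   (empty). *)

(* The vertices of the rooted k-ary tree are the finite words over k letters:
   the root is the empty word and the parent of [a :: w] is [w]. *)
Definition rooted_tree (k : nat) : countType := seq 'I_k.

Definition children k (w : rooted_tree k) : {fset rooted_tree k} :=
  [fset (a :: w : rooted_tree k) | a in 'I_k]%fset.

Definition tree_root k : rooted_tree k := [::].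

(* The regular tree of degree k + 1 is the Cayley graph of the free product of
   k + 1 copies of Z/2 with respect to its k + 1 generators: vertices are words
   without two equal consecutive letters, and the neighbours of a vertex are
   its products with the generators. *)
Definition reduced k (w : seq 'I_k.+1) : bool := sorted [rel a b | a != b] w.

Definition regular_tree (k : nat) : countType := {w : seq 'I_k.+1 | reduced w}.

Definition mul_gen k (a : 'I_k.+1) (w : seq 'I_k.+1) : seq 'I_k.+1 :=
  if w is b :: w' then if a == b then w' else a :: w else [:: a].

Lemma mul_gen_reduced k (a : 'I_k.+1) (w : regular_tree k) :
  reduced (mul_gen a (val w)).
Proof.
case: w => [[|b w]] //= rw; have [//|ab] := eqVneq a b.
  by case: w rw => //= c w /andP[].
by rewrite /reduced /= ab.
Qed.

Definition act k (w : regular_tree k) (a : 'I_k.+1) : regular_tree k :=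
  Sub (mul_gen a (val w)) (mul_gen_reduced a w).

Definition neighbors k (w : regular_tree k) : {fset regular_tree k} :=
  [fset act w a | a in 'I_k.+1]%fset.

(* With [N := neighbors], the vertices at graph distance at most n from r; with
   [N := children], the descendants of r of at most n generations. *)
Fixpoint graph_ball (V : choiceType) (N : V -> {fset V}) (r : V) (n : nat) : {fset V} :=
  if n is m.+1 then (graph_ball N r m `|` \bigcup_(y <- graph_ball N r m) N y)%fset
  else [fset r]%fset.

Lemma mul_genK k (a : 'I_k.+1) (w : regular_tree k) :
  mul_gen a (mul_gen a (val w)) = val w.
Proof.
case: w => [[|b w]] /= rw; first by rewrite eqxx.
have [->|ab] := eqVneq a b; last by rewrite /= eqxx.
by case: w rw => //= c w; case: eqVneq => // -> /andP[]; rewrite /= eqxx.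
Qed.

Lemma actK k (a : 'I_k.+1) : involutive (@act k ^~ a).
Proof. by move=> w; apply: val_inj; exact: mul_genK. Qed.

Lemma act_inj k (w : regular_tree k) : injective (act w).
Proof.
move=> a b /(congr1 val); case: w => [[|c w] rw] /=; first by case.
have [->|ac] := eqVneq a c; have [->//|bc] := eqVneq b c; last by case.
- by move=> /(congr1 size) /= /eqP; rewrite -[X in X == _]addn0 -addn2 eqn_add2l.
- by move=> /(congr1 size) /= /eqP; rewrite -[X in _ == X]addn0 -addn2 eqn_add2l.
Qed.

Lemma card_neighbors k (w : regular_tree k) : #|` neighbors w| = k.+1.
Proof. by rewrite card_imfset ?size_enum_ord//; exact: act_inj. Qed.

Lemma neighbors_sym k (v w : regular_tree k) :
  (v \in neighbors w) = (w \in neighbors v).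
Proof.
by apply/imfsetP/imfsetP => -[a _ ->]; exists a => //=; rewrite actK.
Qed.

Lemma in_levels k n (w : rooted_tree k) :
  (w \in graph_ball (@children k) (@tree_root k) n) = (size w <= n)%N.
Proof.
elim: n w => [|n IH] w; first by rewrite inE; case: w.
rewrite /= inE IH; apply/orP/idP => [[/leqW//|]|].
  by case/bigfcupP => y /andP[]; rewrite IH => yn _ /imfsetP[a _ ->].
rewrite leq_eqVlt ltnS => /orP[/eqP|]; last by left.
case: w => [//|a w] [sw]; right; apply/bigfcupP; exists w.
  by rewrite IH sw leqnn.
by apply/imfsetP; exists a.
Qed.

Definition coordinate_events (V : countType) : set (set (V -> bool)) :=
  [set A | exists x b, A = [set w | w x = b]].

Definition config (V : countType) := g_sigma_algebraType (@coordinate_events V).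

Definition cylinder (V : countType) (A : {fset V}) (a : V -> bool) :
  set (config V) := [set w | forall x, x \in A -> w x = a x].

Definition is_product_measure (R : realType) (V : countType) (p : R)
    (mu : probability (config V) R) :=
  forall (A : {fset V}) (a : V -> bool),
    mu (cylinder A a) = (\prod_(x <- A) bernoulli_pmf p (a x))%:E.

(* Existence: the image of the uniform law on [0, 1[ by the sequence of digits
   of the expanding map [shift], which are independent Bernoulli(p). *)
Section product_measure_exists.
Context (R : realType) (V : countType) (p : R).
Hypothesis p01 : 0 <= p <= 1.

Let m := uniform_prob (@ltr01 R).

Let shift (x : R) : R := if x < p then p^-1 * x else (1 - p)^-1 * (x - p).
Let digit (i : nat) (x : R) : bool := iter i shift x < p.

Let mshift : measurable_fun setT shift.
Proof.
apply: measurable_fun_ifT.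
- exact: measurable_realfun.measurable_fun_ltr.
- exact: measurable_funM.
- by apply: measurable_funM => //; exact: measurable_funB.
Qed.

Let mdigit i : measurable_fun setT (digit i).
Proof.
apply: measurable_realfun.measurable_fun_ltr => //.
elim: i => [|i IH] /=; first exact: measurable_id.
exact: measurableT_comp.
Qed.

Let m_itv (a b : R) : 0 <= a -> a <= b -> b <= 1 -> m `[a, b[%classic = (b - a)%:E.
Proof.
move=> a0 ab b1; rewrite /m /uniform_prob.
rewrite (eq_integral (cst 1%E)); last first.
  move=> x; rewrite inE /= in_itv /= /uniform_pdf subr0 invr1 => /andP[ax xb].
  by rewrite (le_trans a0 ax) (ltW (lt_le_trans xb b1)).
rewrite integral_cst//= mul1e lebesgue_measure_itv /= lte_fin.
case: ltP => // ba; have -> : a = b by apply/le_anti; rewrite ab.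
by rewrite subrr.
Qed.

Let m01 : m `[0, 1[%classic = 1%E.
Proof. by rewrite m_itv ?subr0. Qed.

Fixpoint digit_event (L : seq (option bool)) (i : nat) : set R :=
  if L is o :: L' then
    (if o is Some b then [set x | digit i x = b] else setT) `&` digit_event L' i.+1
  else setT.

Let mevent L i : measurable (digit_event L i).
Proof.
elim: L i => [|[b|] L IH] i /=; [exact: measurableT| |].
- apply: measurableI => //.
  by rewrite -[X in measurable X]setTI; exact: (mdigit i measurableT (Y := [set b])).
- by rewrite setTI.
Qed.

Let w (o : option bool) : R := if o is Some b then bernoulli_pmf p b else 1.

Let wa_ge0 a : 0 <= \prod_(b <- a) bernoulli_pmf p b.
Proof. by apply: prodr_ge0 => b _; exact: bernoulli_pmf_ge0. Qed.

Let shift_event L i x : digit_event L i.+1 x = digit_event L i (shift x).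
Proof.
elim: L i => [//|o L IH] i /=; congr (_ /\ _); last exact: IH.
by case: o => [b|] //=; rewrite /digit iterSr.
Qed.

Fixpoint left_end (a : seq bool) : R :=
  if a is b :: a' then
    if b then p * left_end a' else p + (1 - p) * left_end a' else 0.

Let left_bound a : 0 <= left_end a /\ left_end a + \prod_(b <- a) bernoulli_pmf p b <= 1.
Proof.
move/andP: p01 => [p0 p1].
elim: a => [|b a [IH1 IH2]]; first by rewrite /= big_nil add0r.
have h := wa_ge0 a.
rewrite big_cons; case: b; rewrite /=; split; nra.
Qed.

Let prefix_itv a : digit_event [seq Some b | b <- a] 0 `&` `[0, 1[%classic =
  `[left_end a, left_end a + \prod_(b <- a) bernoulli_pmf p b[%classic.
Proof.
move/andP: p01 => [p0 p1].
elim: a => [|b a IH]; first by rewrite /= big_nil setTI add0r.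
have [h1 h2] := left_bound a; have h3 := wa_ge0 a.
apply/seteqP; split => x.
  move=> [/= [dx]]; rewrite shift_event => ex; rewrite !in_itv /= => /andP[x0 x1].
  have : (digit_event [seq Some b | b <- a] 0 `&` `[0, 1[%classic) (shift x).
    split=> //=; rewrite in_itv /= /shift; case: ltP => xp.
      have pp : 0 < p by exact: le_lt_trans xp.
      by rewrite mulr_ge0 ?invr_ge0//= mulrC ltr_pdivrMr// mul1r.
    have pp : 0 < 1 - p by rewrite subr_gt0; exact: le_lt_trans x1.
    rewrite mulr_ge0 ?invr_ge0 ?subr_ge0//= mulrC ltr_pdivrMr// mul1r.
    by rewrite ltrD2r.
  rewrite IH /= in_itv /= big_cons; move: dx; rewrite /digit /= /shift.
  case: ltP => xp <- /=.
    have pp : 0 < p by exact: le_lt_trans xp.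
    rewrite mulrC ler_pdivlMr// ltr_pdivrMr// => /andP[A B].
    by apply/andP; split; nra.
  have pp : 0 < 1 - p by rewrite subr_gt0; exact: le_lt_trans x1.
  rewrite mulrC ler_pdivlMr// ltr_pdivrMr// => /andP[A B].
  by apply/andP; split; nra.
rewrite /= in_itv /= big_cons => /andP[A B].
have key : (x < p) = b /\ (digit_event [seq Some b | b <- a] 0 `&` `[0, 1[%classic) (shift x).
  rewrite IH /= in_itv /= /shift; case: b A B => /= A B.
    have pp : 0 < p.
      rewrite lt_neqAle p0 andbT; apply/eqP => p00.
      by move: (le_lt_trans A B); rewrite /bernoulli_pmf -p00 !mul0r !addr0 ltxx.
    have xp : x < p by nra.
    rewrite xp; split=> //; rewrite mulrC ler_pdivlMr// ltr_pdivrMr//.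
    by apply/andP; split; nra.
  have pp : 0 < 1 - p.
    rewrite lt_neqAle subr_ge0 p1 andbT; apply/eqP => p00.
    by move: (le_lt_trans A B); rewrite /bernoulli_pmf -p00 !mul0r !addr0 ltxx.
  have xp : p <= x by nra.
  rewrite ltNge xp; split=> //=; rewrite mulrC ler_pdivlMr// ltr_pdivrMr//.
  by apply/andP; split; nra.
case: key => k1 [k2 k3]; split.
  by split; [exact: k1|rewrite shift_event].
move: A B; rewrite in_itv /=; case: (b) => /= A B; apply/andP; split; nra.
Qed.

Let event_cat L1 L2 i :
  digit_event (L1 ++ L2) i = digit_event L1 i `&` digit_event L2 (i + size L1)%N.
Proof.
elim: L1 i => [|o L1 IH] i /=; first by rewrite setTI addn0.
by rewrite IH setIA addSnnS.
Qed.

Let m_event_prefix a L : m (digit_event ([seq Some b | b <- a] ++ L) 0) =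
  (\prod_(b <- a) bernoulli_pmf p b * \prod_(o <- L) w o)%:E.
Proof.
elim: L a => [|[b|] L IH] a.
- rewrite cats0 big_nil mulr1.
  have [h1 h2] := left_bound a; have h3 := wa_ge0 a.
  have <- : m (digit_event [seq Some b | b <- a] 0 `&` `[0, 1[%classic) =
            m (digit_event [seq Some b | b <- a] 0).
    have mI : measurable (`[0, 1[%classic : set R) by exact: measurable_itv.
    rewrite [RHS](measureDI m (mevent _ _) mI) [X in (X + _)%E](_ : _ = 0%E) ?add0e//.
    apply/eqP; rewrite eq_le measure_ge0 andbT.
    have <- : m (~` `[0, 1[%classic) = 0%E by rewrite -(subee (isT : 1%E \is a fin_num)) -[X in (_ - X)%E]m01; exact: (probability_setC m mI).
    apply: le_measure; rewrite ?inE//.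
      by apply: measurableD => //; exact: mevent.
    exact: measurableC.
  rewrite prefix_itv m_itv//; last by rewrite lerDl.
  by congr EFin; ring.
- rewrite -cat_rcons -map_rcons IH big_cons -cats1 big_cat big_seq1 /=.
  by rewrite mulrA.
- have -> : digit_event ([seq Some b | b <- a] ++ None :: L) 0 =
    digit_event ([seq Some b | b <- rcons a true] ++ L) 0 `|`
    digit_event ([seq Some b | b <- rcons a false] ++ L) 0.
    rewrite !map_rcons !cat_rcons !event_cat /= add0n setTI.
    rewrite -setIUr -setIUl; congr (_ `&` _).
    rewrite (_ : _ `|` _ = setT) ?setTI// -subTset => x _ /=.
    by case: (digit _ x); [left|right].
  rewrite [LHS](measureU m (mevent _ _) (mevent _ _)).
    rewrite [X in (X + _)%E]IH [X in (_ + X)%E]IH -EFinD; congr EFin.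
    by rewrite big_cons -!cats1 !big_cat !big_seq1 /bernoulli_pmf /=; ring.
  rewrite !map_rcons !cat_rcons !event_cat /=.
  by apply/seteqP; split => x //= [[_ [-> _]] [_ []]].
Qed.

Let X (x : R) : config V := fun v => digit (choice.pickle v) x.

Let mX : measurable_fun setT X.
Proof.
apply: (@measurability _ _ R (config V) setT X (@coordinate_events V)) => //.
move=> _ [_ [v [b ->]] <-]; rewrite setTI.
by rewrite -[X in measurable X]setTI; exact: (mdigit (choice.pickle v) measurableT (Y := [set b])).
Qed.

Lemma product_measure_exists :
  exists mu : probability (config V) R, is_product_measure p mu.
Proof.
pose T1 : measurableType _ :=
  measurable_structure_g_sigma_algebraType__canonical__measurable_structure_Measurable
    R.-ocitv.-measurable.
have mX' : @measurable_fun _ _ T1 (config V) setT X by exact: mX.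
pose Xm := @mfun_Sub _ _ T1 (config V) X (mem_set mX').
exists (distribution m Xm) => A a.
pose N := (\max_(x <- A) (choice.pickle x).+1)%N.
pose o (i : nat) := if choice.unpickle i is Some x then
  if (x \in A) && (choice.pickle x == i) then Some (a x) else None else None.
pose L := [seq o i | i <- iota 0 N].
have AN x : x \in A -> (choice.pickle x < N)%N.
  by move=> xA; rewrite /N (big_rem x)//= leq_maxl.
have eventL n j x : digit_event [seq o i | i <- iota j n] j x <->
    (forall i, (j <= i < j + n)%N -> if o i is Some b then digit i x = b else True).
  elim: n j => [|n IH] j /=.
    by split=> // _ i ?; lia.
  split=> [[h1 /IH h2] i /andP[]|h].
    rewrite leq_eqVlt => /orP[/eqP<- _|ji ij]; first by case: (o j) h1.
    by apply: h2; lia.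
  split; first by have := h j; case: (o j) => // b; apply; lia.
  apply/IH => i /andP[ji ij]; apply: h.
  lia.
transitivity (m (digit_event L 0)).
  congr (m _); apply/seteqP; split => x.
    move=> h; apply/eventL => i _; rewrite /o.
    case: choice.unpickle => // y; case: ifPn => // /andP[yA /eqP <-]; exact: h.
  move=> /eventL h y yA; have := h (choice.pickle y).
  by rewrite /o choice.pickleK yA eqxx; apply; exact: AN.
have := m_event_prefix [::] L; rewrite big_nil mul1r => ->; congr EFin.
rewrite big_map (bigID (mem [seq choice.pickle x | x <- A])) /= [X in _ * X]big1 ?mulr1; last first.
  move=> i iA; rewrite /o; case E : (choice.unpickle i) => [x|//].
  case: ifPn => // /andP[xA /eqP xi]; case/negP: iA.
  by apply/mapP; exists x.
rewrite -big_filter (perm_big [seq choice.pickle x | x <- A]) /=; last first.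
  apply: uniq_perm; rewrite ?filter_uniq ?iota_uniq//.
    by rewrite map_inj_uniq ?fset_uniq//; exact: (pcan_inj choice.pickleK).
  move=> i; rewrite mem_filter mem_iota; case: mapP => //= -[x xA ->].
  by rewrite add0n AN.
rewrite big_map big_seq [RHS]big_seq; apply: eq_bigr => x xA.
by rewrite /o choice.pickleK xA eqxx.
Qed.

End product_measure_exists.

(* The default value [point] is only used when [p] is not in [0, 1]. *)
Definition product_measure (R : realType) (V : countType) (p : R) :
  probability (config V) R := xget point [set mu | is_product_measure p mu].

Lemma product_measureP (R : realType) (V : countType) (p : R) :
  0 <= p <= 1 -> is_product_measure p (product_measure V p).
Proof.
move=> p01; rewrite /product_measure.
by case: xgetP => // h; have [mu /h] := product_measure_exists V p01.
Qed.

(* [N] is [neighbors] for the FA-jf model and [children] for the OFA-jf model. *)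
Section infinite_volume.
Context (R : realType) (V : countType) (N : V -> {fset V}) (j : nat) (p : R).
Implicit Types (w : config V) (f g : config V -> R) (x : V) (b : bool).

Definition rate w x : R := (j <= \sum_(y <- N x) (1 - w y))%N%:R.

Definition set_at w x b : config V := fun y => if y == x then b else w y.

Definition site_mean x f w : R :=
  \sum_(b : bool) bernoulli_pmf p b * f (set_at w x b).

Definition local_fun f : Prop :=
  exists A : {fset V}, forall w w' : config V,
    (forall x, x \in A -> w x = w' x) -> f w = f w'.

(* For [f] local only finitely many terms are nonzero, as required by the sum
   over a classical set. *)
Definition generator f w : R :=
  \sum_(x \in [set: V]) rate w x * (site_mean x f w - f w).

Local Notation mu := (product_measure V p).

Definition cvg_L2 (u : nat -> config V -> R) f : Prop :=
  ('N[mu]_(2%:E)[EFin \o (u n \- f)%R] @[n --> \oo] --> 0)%E.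

(* Graph of the closure in L^2(mu) of [generator] on local functions.  Local
   functions being a core (bounded finite-range rates), this closure is the
   self-adjoint extension. *)
Definition generator_L2 f g : Prop :=
  [/\ f \in Lfun mu 2%:E, g \in Lfun mu 2%:E
    & exists2 u : nat -> config V -> R, forall n, local_fun (u n)
        & cvg_L2 u f /\ cvg_L2 (fun n => generator (u n)) g].

Definition simple_eigenvalue (a : R) : Prop :=
  exists f0, [/\ generator_L2 f0 (fun w => a * f0 w),
    ~ {ae mu, forall w, f0 w = 0}
    & forall f, generator_L2 f (fun w => a * f w) ->
        exists t : R, {ae mu, forall w, f w = t * f0 w}].

End infinite_volume.

Definition critical_density (R : realType) (V : countType)
    (N : V -> {fset V}) (j : nat) : R :=
  sup [set p : R | 0 <= p < 1 /\ simple_eigenvalue N j p 0].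

Section finite_volume.
Context (R : realType) (V : countType) (N : V -> {fset V}) (j : nat) (p : R).
Variable T : {fset V}.
Implicit Types (h : {ffun T -> bool}) (f : {ffun T -> bool} -> R).

Definition extend0 h : config V := fun x => if insub x is Some y then h y else false.

Definition fin_set_at h (x : T) (b : bool) : {ffun T -> bool} :=
  [ffun y => if y == x then b else h y].

Definition fin_site_mean (x : T) f h : R :=
  \sum_(b : bool) bernoulli_pmf p b * f (fin_set_at h x b).

Definition fin_generator f h : R :=
  \sum_(x : T) rate R N j (extend0 h) (val x) * (fin_site_mean x f h - f h).

Definition fin_mean f : R :=
  \sum_(h : {ffun T -> bool}) (\prod_(x : T) bernoulli_pmf p (h x)) * f h.

Definition fin_var f : R := fin_mean (fun h => (f h - fin_mean f) ^+ 2).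

Definition gap : R :=
  inf [set fin_mean (fun h => f h * - fin_generator f h) / fin_var f
      | f in [set f | ~ exists a : R, forall h, f h = a]].

End finite_volume.

(* Main.v *)
(* Call a vertex blocked if it is occupied and fewer than j of its children are
   not blocked, the vertices h generations below being blocked when occupied.
   Blocking probabilities iterate x |-> p psi(x), where psi(x) is the
   probability that fewer than j of k independent events of probability 1 - x
   occur.

   Lower bound: conditionally on the children of the root being empty, an event
   of probability at least (1 - p)^(k+1), the root is updated freely.  A
   two-block inequality (root, forest below) and the tensorization of the
   variance then lose a constant factor per generation, hence exp(-cn).

   Upper bound: the test function is the indicator that the root is blocked.
   Only flips at the bottom can change it, so its Dirichlet form is the sum over
   the bottom vertices of their influences, a product of n factors
   p psi'(x_i) along the orbit x_i.  If p psi(s) > s for some s, the orbit stays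
   above s, where p psi(x) <= x forces p psi'(x) < 1.

   Such an s exists if p > p_c.  Otherwise psi(x) <= x / p, and for every p' < p
   the blocking probabilities decay geometrically.  Then almost every vertex
   can be freed by finitely many legal flips, so a function in the kernel of
   the generator is invariant under all single flips, hence constant; this is
   carried out on the local functions approximating it. *)

Require Import Defs.
From mathcomp Require Import all_boot all_order all_algebra finmap.
From mathcomp Require Import all_classical all_reals all_analysis.
From mathcomp Require Import polyrcf measurable_realfun zify lra ring.

Set Implicit Arguments.
Unset Strict Implicit.
Unset Printing Implicit Defensive.

Import Order.TTheory GRing.Theory Num.Theory.
Import numFieldNormedType.Exports.
Local Open Scope ring_scope.

(** * Resampling inequalities for product measures *)

(** Both models are treated as one: an orientation away from a root in which every other vertex has
    k children and the root has k or k + 1. In the FA model the parent may help, but a vertex other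
    than the root whose flip decides whether the root is blocked has an occupied parent, so one test
    function serves both. The assumption on p is used only through some s with p psi(s) > s, a
    condition on k, j and p alone.

    In the other direction the density is lowered to p' < p because p psi(x) <= x excludes neither a
    nonzero fixed point nor slow convergence at p itself, while at p' each iteration gains a factor
    p' / p. In the kernel argument the number of flips needed to free a vertex is unbounded; so a
    depth h is fixed, the rare vertices not freed within h generations are paid for by a bounded
    approximation, and h is chosen before the index of the approximating sequence. For small n the
    bound from the blocked root may exceed 1; there the spin of the root is the test function. *)

Section product_space.
Context (R : realType) (p : R) (I : finType).
Implicit Types (h : {ffun I -> bool}) (f g : {ffun I -> bool} -> R) (A B : {set I}).

Definition weight h : R := \prod_(x : I) bernoulli_pmf p (h x).

Definition mean f : R := \sum_h weight h * f h.

(** Conditional means given the coordinates outside [A] are obtained by resampling [A]. They remain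
    functions on the whole space, so they compose without restricting configurations to subsets. *)
Definition mix A h' h : {ffun I -> bool} := [ffun x => if x \in A then h' x else h x].

Definition cond_mean A f h : R := mean (fun h' => f (mix A h' h)).

Definition cond_var A f h : R :=
  cond_mean A (fun h' => f h' ^+ 2) h - cond_mean A f h ^+ 2.

Definition indep A f := forall h h', f (mix A h' h) = f h.

Lemma eq_mean f g : f =1 g -> mean f = mean g.
Proof. by move=> fg; apply: eq_bigr => h _; rewrite fg. Qed.

Lemma eq_cond_mean A f g : f =1 g -> cond_mean A f =1 cond_mean A g.
Proof. by move=> fg h; apply: eq_mean => h'; rewrite fg. Qed.

Lemma meanD f g : mean (fun h => f h + g h) = mean f + mean g.
Proof. by rewrite -big_split; apply: eq_bigr => h _; rewrite mulrDr. Qed.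

Lemma meanZ a f : mean (fun h => a * f h) = a * mean f.
Proof. by rewrite mulr_sumr; apply: eq_bigr => h _; rewrite mulrCA. Qed.

Lemma meanZr a f : mean (fun h => f h * a) = mean f * a.
Proof. by rewrite mulrC -meanZ; apply: eq_mean => h; rewrite mulrC. Qed.

Lemma meanB f g : mean (fun h => f h - g h) = mean f - mean g.
Proof.
rewrite (@eq_mean _ (fun h => f h + -1 * g h)) ?meanD ?meanZ ?mulN1r//.
by move=> h; rewrite mulN1r.
Qed.

Lemma mean_sum J (r : seq J) (P : pred J) (F : J -> {ffun I -> bool} -> R) :
  mean (fun h => \sum_(i <- r | P i) F i h) = \sum_(i <- r | P i) mean (F i).
Proof. by rewrite exchange_big; apply: eq_bigr => h _; rewrite mulr_sumr. Qed.

Lemma mean_prod (G : I -> bool -> R) :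
  mean (fun h => \prod_x G x (h x)) = \prod_x \sum_b bernoulli_pmf p b * G x b.
Proof.
rewrite bigA_distr_bigA; apply: eq_bigr => h _.
by rewrite -big_split.
Qed.

Lemma sum_bernoulli : \sum_b bernoulli_pmf p b = 1.
Proof. by rewrite big_bool /bernoulli_pmf /=; ring. Qed.

Lemma mean_cst a : mean (fun=> a) = a.
Proof.
rewrite (@eq_mean _ (fun h => a * 1)) => [|h]; last by rewrite mulr1.
rewrite meanZ (_ : mean _ = 1) ?mulr1//.
transitivity (\prod_(x : I) \sum_b bernoulli_pmf p b * 1).
  rewrite -(mean_prod (fun _ _ => 1)); apply: eq_mean => h; by rewrite big1.
by rewrite big1// => x _; under eq_bigr do rewrite mulr1; exact: sum_bernoulli.
Qed.

Lemma cond_meanD A f g h :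
  cond_mean A (fun h => f h + g h) h = cond_mean A f h + cond_mean A g h.
Proof. exact: meanD. Qed.

Lemma cond_meanB A f g h :
  cond_mean A (fun h => f h - g h) h = cond_mean A f h - cond_mean A g h.
Proof. exact: meanB. Qed.

Lemma cond_meanZ A a f h :
  cond_mean A (fun h => a * f h) h = a * cond_mean A f h.
Proof. exact: meanZ. Qed.

Lemma mean_prod_in A (G : I -> bool -> R) :
  mean (fun h => \prod_(x in A) G x (h x)) =
  \prod_(x in A) \sum_b bernoulli_pmf p b * G x b.
Proof.
rewrite (@eq_mean _ (fun h => \prod_x if x \in A then G x (h x) else 1)); last first.
  by move=> h; rewrite big_mkcond.
apply: etrans (mean_prod (fun x b => if x \in A then G x b else 1)) _.
rewrite [RHS]big_mkcond; apply: eq_bigr => x _; case: ifP => // _.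
by under eq_bigr do rewrite mulr1; exact: sum_bernoulli.
Qed.

Lemma mean_site x (g : bool -> R) :
  mean (fun h => g (h x)) = \sum_b bernoulli_pmf p b * g b.
Proof.
rewrite (@eq_mean _ (fun h => \prod_(y in [set x]) g (h y))) => [|h]; last first.
  by rewrite big_set1.
by rewrite (mean_prod_in [set x] (fun=> g)) big_set1.
Qed.

Lemma mixA A B h h' h'' : mix B h'' (mix A h' h) = mix (A :|: B) (mix B h'' h') h.
Proof. by apply/ffunP => x; rewrite !ffunE inE; do 2?case: (x \in _). Qed.

Lemma mix_mix A h h' h'' : mix A h'' (mix A h' h) = mix A h'' h.
Proof. by apply/ffunP => x; rewrite !ffunE; case: (x \in _). Qed.

(* Exchanging the coordinates in [A] of two independent copies preserves their
   joint law. *)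
Lemma mean_cond_mean A f : mean (cond_mean A f) = mean f.
Proof.
rewrite /mean /cond_mean /mean.
under eq_bigr do rewrite mulr_sumr.
rewrite pair_big /=.
pose s (u : {ffun I -> bool} * {ffun I -> bool}) := (mix A u.2 u.1, mix A u.1 u.2).
have sK : involutive s.
  by move=> [h h']; congr pair; apply/ffunP => x; rewrite !ffunE; case: (x \in A).
rewrite (reindex_inj (inv_inj sK)) /=.
transitivity (\sum_(u : {ffun I -> bool} * {ffun I -> bool})
   weight u.1 * weight u.2 * f u.1).
  apply: eq_bigr => -[h h'] _ /=; rewrite mulrA; congr (_ * f _).
    rewrite /weight -!big_split; apply: eq_bigr => x _ /=; rewrite !ffunE.
    by case: (x \in A) => //; rewrite mulrC.
  by apply/ffunP => x; rewrite !ffunE; case: (x \in A).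
rewrite -(pair_big xpredT xpredT (fun h h' => weight h * weight h' * f h)) /=.
apply: eq_bigr => h _; under eq_bigr do rewrite mulrAC.
by rewrite -mulr_sumr -[RHS]mulr1 -(mean_cst 1); congr (_ * _); apply: eq_bigr => ? _; rewrite mulr1.
Qed.

Lemma cond_meanU A B f : cond_mean (A :|: B) f =1 cond_mean A (cond_mean B f).
Proof.
move=> h; rewrite /cond_mean -(mean_cond_mean B); apply: eq_mean => h'.
by apply: eq_mean => h''; rewrite mixA.
Qed.

Lemma cond_meanC A B f :
  cond_mean A (cond_mean B f) =1 cond_mean B (cond_mean A f).
Proof. by move=> h; rewrite -!cond_meanU finset.setUC. Qed.

Lemma cond_mean_indep A f : indep A (cond_mean A f).
Proof. by move=> h h'; apply: eq_mean => h''; rewrite mix_mix. Qed.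

Lemma indep_cond_mean A f : indep A f -> cond_mean A f =1 f.
Proof. by move=> fA h; rewrite -[RHS]mean_cst; apply: eq_mean => h'. Qed.

Lemma cond_mean_mul A f g : indep A g ->
  cond_mean A (fun h => g h * f h) =1 fun h => g h * cond_mean A f h.
Proof. by move=> gA h; rewrite -meanZ; apply: eq_mean => h'; rewrite gA. Qed.

Lemma cond_mean_setT f h : cond_mean [set: I] f h = mean f.
Proof.
by apply: eq_mean => h'; congr f; apply/ffunP => x; rewrite ffunE inE.
Qed.

Lemma indepS A B f : A \subset B -> indep B f -> indep A f.
Proof.
move=> AB fB h h'; rewrite -(fB (mix A h' h) h) -(fB h h); congr f.
apply/ffunP => x; rewrite !ffunE; case: ifPn => // xB.
by rewrite (contraNF (fintype.subsetP AB x)).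
Qed.

Lemma mean_mul_indep A f g : indep (~: A) f -> indep A g ->
  mean (fun h => f h * g h) = mean f * mean g.
Proof.
move=> fA gA; rewrite -(mean_cond_mean A).
rewrite (@eq_mean _ (fun h => mean f * g h)) ?meanZ// => h.
rewrite (@eq_cond_mean _ _ (fun h => g h * f h)) => [|h']; last by rewrite mulrC.
rewrite cond_mean_mul// mulrC; congr (_ * _).
rewrite -(cond_mean_setT f h) -(finset.setUCr A) cond_meanU.
by apply: eq_cond_mean => h'; rewrite indep_cond_mean.
Qed.

Lemma mean_prod_indep (J : finType) (C : {set J}) (S : J -> {set I})
    (F : J -> {ffun I -> bool} -> R) :
  (forall i i', i \in C -> i' \in C -> i != i' -> [disjoint S i & S i']) ->
  (forall i, i \in C -> indep (~: S i) (F i)) ->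
  mean (fun h => \prod_(i in C) F i h) = \prod_(i in C) mean (F i).
Proof.
move=> dS iF.
have [n] := ubnP #|C|; elim: n => // n IH in C dS iF *.
have [->|[i iC]] := set_0Vmem C.
  move=> _; rewrite big_set0 -[RHS](mean_cst 1); apply: eq_mean => h.
  by rewrite big_set0.
move=> Cn; rewrite (big_setD1 i)//=.
rewrite (@eq_mean _ (fun h => F i h * \prod_(i' in C :\ i) F i' h)); last first.
  by move=> h; rewrite (big_setD1 i).
rewrite (@mean_mul_indep (S i)); [|exact: iF|].
- congr (_ * _); apply: IH => [i1 i2|i1|].
  + by rewrite !inE => /andP[_ ?] /andP[_ ?]; exact: dS.
  + by rewrite !inE => /andP[_ ?]; exact: iF.
  + by move: Cn; rewrite (cardsD1 i C) iC.
move=> h h' /=; apply: eq_bigr => i'; rewrite !inE => /andP[i'i i'C].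
apply: (@indepS _ (~: S i')); last exact: iF.
by rewrite -finset.disjoints_subset dS// eq_sym.
Qed.

Context (p01 : 0 <= p <= 1).

Lemma weight_ge0 h : 0 <= weight h.
Proof. by apply: prodr_ge0 => x _; exact: bernoulli_pmf_ge0. Qed.

Lemma ler_mean f g : (forall h, f h <= g h) -> mean f <= mean g.
Proof. by move=> fg; apply: ler_sum => h _; rewrite ler_wpM2l ?weight_ge0. Qed.

Lemma mean_ge0 f : (forall h, 0 <= f h) -> 0 <= mean f.
Proof. by move=> f0; apply: sumr_ge0 => h _; rewrite mulr_ge0 ?weight_ge0. Qed.

Lemma ler_cond_mean A f g h : (forall h, f h <= g h) -> cond_mean A f h <= cond_mean A g h.
Proof. by move=> fg; exact: ler_mean. Qed.

Lemma cond_varE A f h :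
  cond_var A f h = cond_mean A (fun h' => (f h' - cond_mean A f h') ^+ 2) h.
Proof.
rewrite (@eq_cond_mean _ _ (fun h' => f h' ^+ 2 - cond_mean A f h' * (2 * f h')
   + cond_mean A f h' ^+ 2)) => [|h']; last by ring.
rewrite cond_meanD cond_meanB cond_mean_mul; last exact: cond_mean_indep.
rewrite [X in _ = _ + X]indep_cond_mean => [|h1 h2]; last by rewrite cond_mean_indep.
by rewrite cond_meanZ /cond_var; ring.
Qed.

Lemma cond_var_ge0 A f h : 0 <= cond_var A f h.
Proof. by rewrite cond_varE; apply: mean_ge0 => h'; exact: sqr_ge0. Qed.

Lemma sqr_cond_mean_le A f h : cond_mean A f h ^+ 2 <= cond_mean A (fun h => f h ^+ 2) h.
Proof. by rewrite -subr_ge0; exact: cond_var_ge0. Qed.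

Lemma cond_var_le A f h : cond_var A f h <= cond_mean A (fun h => f h ^+ 2) h.
Proof. by rewrite lerBlDr lerDl sqr_ge0. Qed.

Lemma cond_varD_le A f g h :
  cond_var A f h <= 2 * cond_var A g h + 2 * cond_var A (fun h => f h - g h) h.
Proof.
rewrite !cond_varE -!cond_meanZ -cond_meanD; apply: ler_cond_mean => {}h.
rewrite cond_meanB -subr_ge0.
set a := f h; set b := cond_mean A f h; set c := g h; set d := cond_mean A g h.
rewrite (_ : _ - _ = (c - d - (a - c - (b - d))) ^+ 2) ?sqr_ge0//; ring.
Qed.

Lemma mean_cond_var A f :
  mean (cond_var A f) = mean (fun h => (f h - cond_mean A f h) ^+ 2).
Proof.
by rewrite (eq_mean (cond_varE A f)) mean_cond_mean.
Qed.

Lemma mean_cond_varB A f :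
  mean (cond_var A f) = mean (fun h => f h ^+ 2) - mean (fun h => cond_mean A f h ^+ 2).
Proof. by rewrite meanB mean_cond_mean. Qed.

(** Law of total variance. *)
Lemma mean_cond_varU_eq A B f :
  mean (cond_var (A :|: B) f) = mean (cond_var B f) + mean (cond_var A (cond_mean B f)).
Proof.
rewrite !mean_cond_varB (@eq_mean (fun h => cond_mean (A :|: B) f h ^+ 2)
  (fun h => cond_mean A (cond_mean B f) h ^+ 2)) => [|h]; last by rewrite cond_meanU.
by ring.
Qed.

(** Averaging over [B] commutes with averaging over [A] and contracts the L2 norm. With the law of
    total variance this gives tensorization, even for overlapping sets. *)
Lemma mean_cond_var_cond_mean A B f :
  mean (cond_var A (cond_mean B f)) <= mean (cond_var A f).
Proof.
rewrite !mean_cond_var.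
rewrite (@eq_mean _ (fun h => cond_mean B (fun h => f h - cond_mean A f h) h ^+ 2)); last first.
  by move=> h; rewrite cond_meanC cond_meanB.
rewrite -[leRHS](mean_cond_mean B); apply: ler_mean => h; exact: sqr_cond_mean_le.
Qed.

Lemma mean_cond_varU A B f :
  mean (cond_var (A :|: B) f) <= mean (cond_var A f) + mean (cond_var B f).
Proof.
by rewrite mean_cond_varU_eq addrC lerD2r; exact: mean_cond_var_cond_mean.
Qed.

Lemma cond_mean_set0 f : cond_mean finset.set0 f =1 f.
Proof.
move=> h; rewrite -[RHS]mean_cst; apply: eq_mean => h'; congr f.
by apply/ffunP => x; rewrite ffunE inE.
Qed.

Lemma mean_cond_var_bigU (J : finType) (C : {set J}) (S : J -> {set I}) f :
  mean (cond_var (\bigcup_(i in C) S i)%SET f) <= \sum_(i in C) mean (cond_var (S i) f).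
Proof.
have [n] := ubnP #|C|; elim: n => // n IH in C *.
have [->|[i iC]] := set_0Vmem C.
  rewrite !big_set0 (@eq_mean _ (fun=> 0)) ?mean_cst// => h.
  by rewrite /cond_var !cond_mean_set0 subrr.
move=> Cn; rewrite !(big_setD1 i iC)/=; apply: (le_trans (mean_cond_varU _ _ _)).
by rewrite lerD2l IH//; move: Cn; rewrite (cardsD1 i C) iC.
Qed.

End product_space.

Section product_space_more.
Context (R : realType) (p : R) (I : finType).
Implicit Types (h : {ffun I -> bool}) (f g : {ffun I -> bool} -> R) (A B : {set I}).
Local Notation mean := (mean p).
Local Notation cond_mean := (cond_mean p).
Local Notation cond_var := (cond_var p).

Lemma indepP (T : Type) A (F : {ffun I -> bool} -> T) :
  (forall h h', F (mix A h' h) = F h) ->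
  forall h h', (forall x, x \notin A -> h x = h' x) -> F h = F h'.
Proof.
move=> FA h h' hh'; rewrite -(FA h h'); congr F.
by apply/ffunP => x; rewrite ffunE; case: ifPn => // /hh'.
Qed.

Lemma indep_cond_meanr A B f : indep B f -> indep B (cond_mean A f).
Proof.
move=> fB h h'; apply: eq_mean => h''; apply: (indepP fB) => x xB.
by rewrite !ffunE (negbTE xB).
Qed.

Lemma indep_cond_varr A B f : indep B f -> indep B (cond_var A f).
Proof.
move=> fB h h'; rewrite /cond_var (indep_cond_meanr _ fB); congr (_ - _).
by apply: (@indep_cond_meanr A B (fun h => f h ^+ 2)) => h1 h2; rewrite fB.
Qed.

(** Links the generator to conditional variances: a rate that does not read [A] factors out of the
    average over [A]. *)
Lemma mean_dirichlet A f (c : {ffun I -> bool} -> R) : indep A c ->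
  mean (fun h => f h * (c h * (f h - cond_mean A f h))) =
  mean (fun h => c h * cond_var A f h).
Proof.
move=> cA; rewrite -(mean_cond_mean p A); apply: eq_mean => h.
rewrite (@eq_cond_mean _ _ _ _ _ (fun h => c h * (f h ^+ 2 - cond_mean A f h * f h))).
  rewrite cond_mean_mul// cond_meanB cond_mean_mul; last exact: cond_mean_indep.
  by rewrite /cond_var expr2.
by move=> h'; ring.
Qed.

Lemma cond_mean1 x f h :
  cond_mean [set x] f h =
  \sum_b bernoulli_pmf p b * f [ffun y => if y == x then b else h y].
Proof.
rewrite -(mean_site p x (fun b => f [ffun y => if y == x then b else h y])).
apply: eq_mean => h'; congr f; apply/ffunP => y; rewrite !ffunE inE.
by case: eqP => // ->.
Qed.

Context (p01 : 0 <= p <= 1).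

(* Since [g] is independent of [cond_mean F f], multiplying by [g] costs only its
   mean; then [cond_mean F f] is traded for [f] at the cost of the variance on
   [F]. *)
Lemma block_poincare F x f g :
  indep (~: F) g -> x \notin F -> (forall h, 0 <= g h <= 1) -> 0 < mean g ->
  mean (cond_var (x |: F) f) <= (1 + 2 / mean g) *
    (mean (cond_var F f) + mean (fun h => g h * cond_var [set x] f h)).
Proof.
move=> gF xF g01 g0; rewrite finset.setUC finset.setUC mean_cond_varU_eq.
set u := cond_mean F f; set V := mean (cond_var F f); set G := mean (fun h => _ * _).
have G0 : 0 <= G.
  by apply: mean_ge0 => // h; case/andP: (g01 h) => *; rewrite mulr_ge0// cond_var_ge0.
suff : mean g * mean (cond_var [set x] u) <= 2 * (V + G).
  rewrite mulrC -ler_pdivlMr// => H; rewrite mulrDl mul1r.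
  apply: (@le_trans _ _ (V + 2 * (V + G) / mean g)); first by rewrite lerD2l.
  rewrite [2 * (V + G) / _]mulrAC; lra.
rewrite -(@mean_mul_indep _ _ _ F)//; last first.
  by apply: indep_cond_varr; exact: cond_mean_indep.
have H h : g h * cond_var [set x] u h <=
    2 * (g h * cond_var [set x] f h) + 2 * cond_var [set x] (fun h => u h - f h) h.
  have /andP[g0h g1h] := g01 h.
  have := cond_varD_le p01 [set x] u f h.
  have := cond_var_ge0 p01 [set x] f h.
  have := cond_var_ge0 p01 [set x] (fun h => u h - f h) h.
  nra.
apply: (le_trans (ler_mean p01 H)); rewrite meanD !meanZ mulrDr addrC lerD2r ler_pM2l//.
apply: (@le_trans _ _ (mean (cond_mean [set x] (fun h => (u h - f h) ^+ 2)))).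
  by apply: ler_mean => // h; exact: cond_var_le.
rewrite mean_cond_mean /V mean_cond_var//; apply: ler_mean => // h.
by rewrite -sqrrN opprB.
Qed.

Definition dirichlet (c : I -> {ffun I -> bool} -> R) f :=
  \sum_x mean (fun h => c x h * cond_var [set x] f h).

End product_space_more.

(** * Finite rooted trees and their Poincaré inequality *)

Record finite_tree (I : finType) (n : nat) := FiniteTree {
  lev : I -> nat;
  par : I -> I;
  root : I;
  lev_par : forall x, lev (par x) = (lev x).-1;
  lev_root : lev root = 0%N;
  lev_eq0 : forall x, lev x = 0%N -> x = root;
  lev_max : forall x, (lev x <= n)%N }.

Section finite_tree.
Context (I : finType) (n : nat) (T : finite_tree I n).
Local Notation lev := (lev T).
Local Notation par := (par T).
Local Notation root := (root T).

(** The axioms force [par] to fix the root; the condition on the level keeps the root from being its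
    own child. *)
Definition kids x : {set I} := [set y | (0 < lev y)%N && (par y == x)].
Definition subtree x : {set I} :=
  [set y | (lev x <= lev y)%N && (iter (lev y - lev x) par y == x)].

Lemma kids_lev x y : y \in kids x -> lev y = (lev x).+1.
Proof. by rewrite inE => /andP[y0 /eqP <-]; rewrite lev_par prednK. Qed.

Lemma kids_par x y : y \in kids x -> par y = x.
Proof. by rewrite inE => /andP[_ /eqP]. Qed.

Lemma lev_iter i x : lev (iter i par x) = (lev x - i)%N.
Proof. by elim: i => [|i IH] /=; rewrite ?subn0// lev_par IH subnS. Qed.

Lemma subtree_id x : x \in subtree x.
Proof. by rewrite inE leqnn subnn /=. Qed.

Lemma subtree_lev x y : y \in subtree x -> (lev x <= lev y)%N.
Proof. by rewrite inE => /andP[]. Qed.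

Lemma subtree_root : subtree root = [set: I].
Proof.
apply/setP => y; rewrite !inE lev_root /= subn0; apply/eqP/lev_eq0.
by rewrite lev_iter subnn.
Qed.

Lemma subtreeE x : subtree x = x |: \bigcup_(y in kids x) subtree y.
Proof.
apply/setP => z; rewrite in_setU1; apply/idP/orP.
  rewrite inE leq_eqVlt => /andP[/orP[/eqP xz|xz] /eqP zx].
    by left; move: zx; rewrite xz subnn /= => ->.
  right; apply/finset.bigcupP; exists (iter (lev z - (lev x).+1) par z).
    by rewrite inE lev_iter subKn//= -iterS subnSK//; apply/eqP.
  by rewrite inE !lev_iter subKn// xz eqxx.
case=> [/eqP->|/finset.bigcupP[y yx]]; first exact: subtree_id.
rewrite !inE (kids_lev yx) => /andP[xz /eqP zy]; rewrite ltnW//=.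
by apply/eqP; rewrite -[RHS](kids_par yx) -zy -iterS subnSK.
Qed.

Lemma subtree_kids_notin x : x \notin (\bigcup_(y in kids x) subtree y)%SET.
Proof.
apply/negP => /finset.bigcupP[y /kids_lev yx /subtree_lev].
by rewrite yx ltnn.
Qed.

Lemma subtree_trans x y : y \in kids x -> subtree y \subset subtree x.
Proof.
move=> yx; apply/fintype.subsetP => w wy; rewrite (subtreeE x) in_setU1.
by apply/orP; right; apply/finset.bigcupP; exists y.
Qed.

(** A vertex has only one ancestor on the common level of [y] and [z]. *)
Lemma subtree_disjoint x y z : y \in kids x -> z \in kids x -> y != z ->
  [disjoint subtree y & subtree z].
Proof.
move=> yx zx yz; rewrite disjoint_subset; apply/fintype.subsetP => w.
rewrite !inE (kids_lev yx) (kids_lev zx) => /andP[-> /eqP ->] /=.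
exact: yz.
Qed.

Lemma sum_subtree (M : nmodType) x (F : I -> M) :
  \sum_(y in subtree x) F y = F x + \sum_(z in kids x) \sum_(y in subtree z) F y.
Proof.
rewrite subtreeE big_setU1 ?subtree_kids_notin//=; congr (_ + _).
pose anc w := iter (lev w - (lev x).+1) par w.
rewrite (partition_big anc (mem (kids x))) /=; last first.
  move=> w /finset.bigcupP[y yx]; rewrite inE (kids_lev yx) => /andP[_ /eqP wy].
  by rewrite /anc wy.
apply: eq_bigr => z zx; apply: eq_bigl => w; apply/andP/idP.
  case=> /finset.bigcupP[y yx /subtree_lev]; rewrite (kids_lev yx) => xw /eqP wz.
  by rewrite inE (kids_lev zx) xw /=; exact/eqP.
move=> wz; split; first by apply/finset.bigcupP; exists z.
by move: wz; rewrite inE (kids_lev zx) => /andP[].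
Qed.

Section poincare.
Context (R : realType) (p : R) (p01 : 0 < p < 1) (K : nat).
Context (card_kids : forall x, (#|kids x| <= K)%N).
Context (c : I -> {ffun I -> bool} -> R).

Definition free_kids x (h : {ffun I -> bool}) : R :=
  \prod_(y in kids x) (~~ h y)%:R.

Context (c_free : forall x h, free_kids x h <= c x h).

(** The factor of [block_poincare] when [g] is the event that all children, at most [K] of them, are
    empty. *)
Definition block_const : R := 1 + 2 / (1 - p) ^+ K.

Lemma mean_free_kids x : mean p (free_kids x) = (1 - p) ^+ #|kids x|.
Proof.
rewrite /free_kids (mean_prod_in p (kids x) (fun y b => (~~ b)%:R)).
rewrite -prodr_const.
by apply: eq_bigr => y _; rewrite big_bool /bernoulli_pmf /=; ring.
Qed.

Lemma block_const_gt1 : 1 < block_const.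
Proof.
case/andP: p01 => p0 p1; rewrite ltrDl divr_gt0// exprn_gt0// subr_gt0//.
Qed.

Lemma subtree_poincare x f :
  mean p (cond_var p (subtree x) f) <= block_const ^+ (n - lev x) *
    \sum_(y in subtree x) mean p (fun h => c y h * cond_var p [set y] f h).
Proof.
have p01' : 0 <= p <= 1 by case/andP: p01 => *; rewrite !ltW.
have [d] := ubnP (n - lev x)%N; elim: d => // d IH in x *.
rewrite ltnS => xd.
have free01 h : 0 <= free_kids x h <= 1.
  rewrite /free_kids prodr_ge0//=; apply: prodr_ile1 => y _.
  by case: (h y) => /=; rewrite ?lexx ?ler01.
have VG : mean p (fun h => free_kids x h * cond_var p [set x] f h) <=
    mean p (fun h => c x h * cond_var p [set x] f h).
  by apply: ler_mean => // h; rewrite ler_wpM2r// cond_var_ge0.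
have C1 := ltW block_const_gt1.
have C0 : 0 <= block_const := le_trans ler01 C1.
have c0 y h : 0 <= c y h by apply: le_trans (c_free y h); exact: prodr_ge0.
have D0 y : 0 <= mean p (fun h => c y h * cond_var p [set y] f h).
  by apply: mean_ge0 => // h; rewrite mulr_ge0// cond_var_ge0.
(* At level [n] there are no children: [free_kids] is an empty product and [x] is updated freely. *)
have [xn|xn] := leqP n (lev x).
  have k0 : kids x = finset.set0.
    apply/setP => y; rewrite finset.in_set0; apply/negP => /kids_lev yx.
    by have := lev_max T y; rewrite yx ltnNge xn.
  move: VG; rewrite sum_subtree subtreeE k0 !big_set0 addr0 finset.setU0.
  rewrite (_ : (n - lev x = 0)%N) ?expr0 ?mul1r; last by lia.
  move=> VG; apply: le_trans VG; apply: ler_mean => // h.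
  by rewrite /free_kids k0 big_set0 mul1r.
rewrite {1}subtreeE.
have q0 : 0 < (1 - p) by case/andP: p01 => *; rewrite subr_gt0.
apply: (le_trans (@block_poincare _ _ _ p01' _ x f (free_kids x) _ _ _ _)) => //.
- move=> h h'; apply: eq_bigr => y yx; rewrite ffunE finset.in_setC.
  by rewrite (_ : y \in _)//; apply/finset.bigcupP; exists y => //; exact: subtree_id.
- exact: subtree_kids_notin.
- by rewrite mean_free_kids exprn_gt0.
rewrite mean_free_kids (_ : (n - lev x = (n - (lev x).+1).+1)%N); last by lia.
rewrite exprS -mulrA; apply: ler_pM => //.
- by rewrite addr_ge0// divr_ge0// exprn_ge0// ltW.
- rewrite addr_ge0 ?mean_ge0// => h; first exact: cond_var_ge0.
  by rewrite mulr_ge0 ?cond_var_ge0//; case/andP: (free01 h).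
- rewrite lerD2l ler_pM2l// lef_pV2 ?posrE ?exprn_gt0//.
  by apply: ler_wiXn2l (card_kids x); [exact: ltW|case/andP: p01 => *; lra].
(* The term of [x] needs no constant, a power of [block_const] being at least 1; the variance on the
   forest tensorizes over the subtrees of the children. *)
rewrite sum_subtree mulrDr addrC; apply: lerD.
  apply: (le_trans VG); rewrite -[leLHS]mul1r ler_wpM2r//; exact: exprn_ege1.
apply: (le_trans (mean_cond_var_bigU p01' _ _ _)); rewrite mulr_sumr.
apply: ler_sum => y yx; rewrite -(kids_lev yx); apply: IH.
by rewrite (kids_lev yx); lia.
Qed.

Lemma mean_var_setT f :
  mean p (fun h => (f h - mean p f) ^+ 2) = mean p (cond_var p [set: I] f).
Proof.
rewrite mean_cond_var; apply: eq_mean => h'; by rewrite cond_mean_setT.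
Qed.

Lemma tree_poincare f :
  mean p (fun h => (f h - mean p f) ^+ 2) <= block_const ^+ n * dirichlet p c f.
Proof.
rewrite mean_var_setT -?subtree_root.
have := subtree_poincare root f; rewrite lev_root subn0 => /le_trans; apply.
by rewrite subtree_root /dirichlet; under eq_bigl do rewrite inE.
Qed.

End poincare.

End finite_tree.

(** * Blocked vertices and their influences *)

Section binomial.
Context (R : realType).
Implicit Types (s : R).

(** The law of the number of children that are not blocked, among [k] children blocked independently
    with probability [s]. Thus [binom_cdf k j] is the function psi. *)
Definition binom_pmf (k i : nat) s : R :=
  'C(k, i)%:R * (1 - s) ^+ i * s ^+ (k - i).

Definition binom_cdf (k j : nat) s : R := \sum_(i < j) binom_pmf k i s.

Lemma binom_pmf_ge0 k i s : 0 <= s <= 1 -> 0 <= binom_pmf k i s.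
Proof. by case/andP=> *; rewrite !mulr_ge0 ?exprn_ge0// subr_ge0. Qed.

Lemma sum_binom_pmf k s : \sum_(i < k.+1) binom_pmf k i s = 1.
Proof.
rewrite -(expr1n _ k) -[X in X ^+ k](subrK s 1) addrC exprDn.
by apply: eq_bigr => i _; rewrite /binom_pmf -mulr_natl; ring.
Qed.

Lemma binom_cdf01 k j s : 0 <= s <= 1 -> (j <= k.+1)%N -> 0 <= binom_cdf k j s <= 1.
Proof.
move=> s01 jk; rewrite sumr_ge0 => [/=|i _]; last exact: binom_pmf_ge0.
rewrite -(sum_binom_pmf k s) -(subnKC jk) big_split_ord /= lerDl.
by apply: sumr_ge0 => i _; exact: binom_pmf_ge0.
Qed.

Lemma binom_pmf_le1 k i s : 0 <= s <= 1 -> binom_pmf k i s <= 1.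
Proof.
move=> s01; have [ik|ki] := leqP i k; last by rewrite /binom_pmf bin_small// !mul0r.
rewrite -(sum_binom_pmf k s) (bigD1 (Ordinal (ik : (i < k.+1)%N)))//= lerDl.
by apply: sumr_ge0 => i' _; exact: binom_pmf_ge0.
Qed.

End binomial.

Section binomial_law.
Context (R : realType) (p : R) (I : finType).
Implicit Types (h : {ffun I -> bool}).

Context (J : finType) (C : {set J}) (S : J -> {set I})
  (b : J -> {ffun I -> bool} -> bool) (s : R).
Context (dS : forall i i', i \in C -> i' \in C -> i != i' -> [disjoint S i & S i']).
Context (bS : forall i h h', i \in C -> b i (mix (~: S i) h' h) = b i h).
Context (bs : forall i, i \in C -> mean p (fun h => (b i h)%:R) = s).

(** Split according to the set [D] of indices where [b] fails: the indicator of each [D] is a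
    product of functions of disjoint sets of coordinates. *)
Lemma mean_count_eq i :
  mean p (fun h => (#|[set z in C | ~~ b z h]| == i)%:R) = binom_pmf #|C| i s.
Proof.
pose F (D : {set J}) h : R := \prod_(z in C) (if z \in D then ~~ b z h else b z h)%:R.
have FE (D : {set J}) h : D \subset C -> F D h = ([set z in C | ~~ b z h] == D)%:R.
  move=> DC; have [<-|nD] := eqVneq.
    by rewrite /F big1// => z zC; rewrite inE zC /=; case: (b z h).
  have [z zD] : exists z, (z \in [set z in C | ~~ b z h]) != (z \in D).
    apply/existsP; apply: contraNT nD => /existsPn nD; apply/eqP/setP => z.
    by apply/eqP; have := nD z; rewrite negbK.
  have zC : z \in C.
    by apply: contraNT zD => zC; rewrite inE (negbTE zC) (contraNF (fintype.subsetP DC z)).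
  rewrite /F (bigD1 z)//=; move: zD; rewrite inE zC /=.
  by case: (b z h); case: (z \in D); rewrite ?mul0r.
rewrite (@eq_mean _ _ _ _ (fun h => \sum_(D : {set J} | (D \subset C) && (#|D| == i)) F D h)); last first.
  move=> h; set D0 := [set z in C | ~~ b z h].
  have D0C : D0 \subset C by apply/fintype.subsetP => z; rewrite inE => /andP[].
  have [Di|Di] := eqVneq #|D0| i.
    rewrite (bigD1 D0)/= ?D0C ?Di ?eqxx// FE// eqxx big1 ?addr0// => D.
    by case/andP => /andP[DC _] nD; rewrite FE// eq_sym (negbTE nD).
  rewrite big1// => D /andP[DC Di']; rewrite FE//.
  by case: eqP => // E; rewrite -E in Di'; rewrite Di' in Di.
rewrite mean_sum (eq_bigr (fun=> (1 - s) ^+ i * s ^+ (#|C| - i))); last first.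
  move=> D /andP[DC /eqP Di].
  rewrite (@mean_prod_indep _ _ _ _ _ S) => //; last first.
    by move=> z zC h h'; rewrite bS.
  rewrite (eq_bigr (fun z => if z \in D then 1 - s else s)) => [|z zC]; last first.
    case: (z \in D); last exact: bs.
    rewrite (@eq_mean _ _ _ _ (fun h => 1 - (b z h)%:R)); last first.
      by move=> h; case: (b z h); rewrite ?subrr ?subr0.
    by rewrite meanB mean_cst bs.
  rewrite (bigID (mem D))/=; congr (_ * _).
    rewrite (eq_bigl (mem D)) => [|z]; last first.
      rewrite !inE andbC; apply/andb_idr; exact: (fintype.subsetP DC).
    by rewrite -Di -prodr_const; apply: eq_bigr => z /= ->.
  rewrite (eq_bigl (mem (C :\: D))) => [|z]; last by rewrite !inE andbC.
  rewrite -Di -(cardsDS DC) -prodr_const; apply: eq_bigr => z.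
  by rewrite !inE => /andP[/negbTE ->].
rewrite big_const iter_addr_0 -mulr_natl /binom_pmf -mulrA; congr (_%:R * _).
rewrite -(cards_draws C i) cardsE; apply: eq_card => D.
by [].
Qed.

Lemma mean_count_lt j :
  mean p (fun h => (#|[set z in C | ~~ b z h]| < j)%:R) = binom_cdf #|C| j s.
Proof.
rewrite /binom_cdf; under [RHS]eq_bigr do rewrite -mean_count_eq.
rewrite -mean_sum; apply: eq_mean => h; set m := #|_|.
case: (ltnP m j) => mj.
  rewrite (bigD1 (Ordinal mj))//= eqxx big1 ?addr0// => i /negbTE mi.
  by rewrite -(inj_eq val_inj) /= eq_sym in mi; rewrite mi.
by rewrite big1// => i _; case: eqP => // mi; have := ltn_ord i; rewrite -mi ltnNge mj.
Qed.

End binomial_law.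

Section blocked.
Context (R : realType) (I : finType) (n : nat) (T : finite_tree I n) (j : nat) (p : R).
Local Notation lev := (lev T).
Local Notation par := (par T).
Local Notation root := (root T).
Local Notation kids := (kids T).
Local Notation subtree := (subtree T).
Implicit Types (w : {ffun I -> bool}) (f : {ffun I -> bool} -> R).

(* [x] stays occupied under the dynamics constrained by the children, run on
   the first [h] generations of its subtree with occupied boundary. *)
Fixpoint blocked h x w : bool :=
  if h is h'.+1 then w x && (#|[set y in kids x | ~~ blocked h' y w]| < j)%N
  else w x.

Lemma blocked_local h x w w' :
  (forall y, y \in subtree x -> w y = w' y) -> blocked h x w = blocked h x w'.
Proof.
elim: h x => [|h IH] x ww' /=; first by rewrite ww' ?subtree_id.
rewrite ww' ?subtree_id//; congr (_ && (_ < _)%N); apply: eq_card => y.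
rewrite !inE; case: (boolP ((0 < lev y)%N && (par y == x))) => //= yx; congr negb; apply: IH => z zy.
by apply: ww'; apply: (fintype.subsetP (subtree_trans _)) zy; rewrite inE.
Qed.

Lemma blocked_mix h x w w' : blocked h x (mix (~: subtree x) w' w) = blocked h x w.
Proof.
by apply: blocked_local => y yx; rewrite ffunE finset.in_setC yx.
Qed.

Lemma blocked_occ h x w : blocked h x w -> w x.
Proof. by case: h => //= h /andP[]. Qed.

Fixpoint blocked_prob (k : nat) h : R :=
  if h is h'.+1 then p * binom_cdf k j (blocked_prob k h') else p.

Lemma blocked_prob01 k h : 0 <= p <= 1 -> (j <= k.+1)%N -> 0 <= blocked_prob k h <= 1.
Proof.
move=> p01 jk; elim: h => //= h /binom_cdf01 /(_ jk) /andP[c0 c1].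
by case/andP: p01 => p0 p1; rewrite mulr_ge0//= mulr_ile1.
Qed.

Context (p01 : 0 <= p <= 1) (k : nat).
Context (card_kids : forall x, (0 < lev x < n)%N -> #|kids x| = k).

Lemma mean_occ x : mean p (fun w => (w x)%:R) = p.
Proof. by rewrite (mean_site p x (fun b => b%:R)) big_bool /bernoulli_pmf /=; ring. Qed.

(** The generality in [C] and [P] covers two uses: fewer than [j] among all children, and exactly
    [j.-1] among the siblings of a given child. *)
Lemma mean_occ_count h x (C : {set I}) (P : nat -> bool) : C \subset kids x ->
  mean p (fun w => (w x && P #|[set y in C | ~~ blocked h y w]|)%:R) =
  p * mean p (fun w => (P #|[set y in C | ~~ blocked h y w]|)%:R).
Proof.
move=> Cx; rewrite -{2}(mean_occ x) -(@mean_mul_indep _ _ _ [set x]).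
- by apply: eq_mean => w; rewrite -natrM mulnb.
- by move=> w w'; rewrite ffunE !inE eqxx.
move=> w w'; congr ((P _)%:R); apply: eq_card => y; rewrite !inE.
case: (boolP (y \in C)) => //= yC; congr (~~ _); apply: blocked_local => z zy.
rewrite ffunE inE; case: eqP => // zx.
have := subtree_lev zy; rewrite zx (kids_lev (fintype.subsetP Cx _ yC)).
by rewrite ltnn.
Qed.

(** The root is excluded because it may have k + 1 children; the bound on [lev x + h] keeps the
    recursion at vertices with exactly [k] children. *)
Lemma mean_blocked h x : (0 < lev x)%N -> (lev x + h <= n)%N ->
  mean p (fun w => (blocked h x w)%:R) = blocked_prob k h.
Proof.
elim: h x => [|h IH] x x0 xn; first exact: mean_occ.
rewrite /= (mean_occ_count h (fun m => m < j)%N (fintype.subxx _)); congr (_ * _).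
rewrite -{1}(card_kids (x := x)); last by rewrite x0; lia.
apply: mean_count_lt.
- by move=> y z; exact: subtree_disjoint.
- by move=> y w w' _; exact: blocked_mix.
- by move=> y yx; apply: IH; rewrite (kids_lev yx)//; lia.
Qed.

End blocked.

Section flip.
Context (R : realType) (p : R) (I : finType).
Implicit Types (w : {ffun I -> bool}) (f g u v : {ffun I -> bool} -> R).

Definition upd w x b : {ffun I -> bool} := [ffun y => if y == x then b else w y].

Lemma cond_var1 x f w :
  cond_var p [set x] f w = p * (1 - p) * (f (upd w x true) - f (upd w x false)) ^+ 2.
Proof.
rewrite /cond_var !cond_mean1 !big_bool /bernoulli_pmf /= -!/(upd _ _ _); ring.
Qed.

Lemma cond_var_affine A u v g w : indep A u -> indep A v ->
  cond_var p A (fun w => u w + v w * g w) w = v w ^+ 2 * cond_var p A g w.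
Proof.
move=> uA vA; rewrite !cond_varE -(@cond_mean_mul _ _ _ A _ (fun w => v w ^+ 2));
  last by move=> w1 w2; rewrite vA.
apply: eq_cond_mean => {}w; rewrite cond_meanD cond_mean_mul// indep_cond_mean//.
by ring.
Qed.

Lemma eq_cond_var A f g : f =1 g -> cond_var p A f =1 cond_var p A g.
Proof.
move=> fg w; rewrite /cond_var (eq_cond_mean _ _ fg); congr (_ - _).
by apply: eq_cond_mean => w'; rewrite fg.
Qed.

End flip.

Section influence.
Context (R : realType) (I : finType) (n : nat) (T : finite_tree I n) (j : nat) (p : R).
Local Notation lev := (lev T).
Local Notation par := (par T).
Local Notation root := (root T).
Local Notation kids := (kids T).
Local Notation subtree := (subtree T).
Local Notation blocked := (blocked T j).
Local Notation lam := (blocked_prob j p).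
Implicit Types (w : {ffun I -> bool}) (f : {ffun I -> bool} -> R).
Context (p01 : 0 <= p <= 1) (j0 : (0 < j)%N) (k : nat) (jk : (j <= k.+1)%N).
Context (card_kids : forall x, (0 < lev x < n)%N -> #|kids x| = k).

Definition bottom_influence h x : R :=
  \sum_(y in subtree x | lev y == (lev x + h)%N)
    mean p (cond_var p [set y] (fun w => (blocked h x w)%:R)).

(** The derivative psi'(s), by [deriv_cdf_poly]: the mean number of children whose state alone
    decides whether fewer than [j] of the [k] are unblocked. *)
Definition cdf_slope (s : R) : R := k%:R * binom_pmf k.-1 j.-1 s.

Lemma bottom_influence0 x : bottom_influence 0 x <= 1.
Proof.
rewrite /bottom_influence (big_pred1 x) => [|y]; last first.
  apply/andP/idP => [[yx]|/eqP ->]; last by rewrite subtree_id addn0.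
  rewrite addn0 => /eqP xy; move: yx; rewrite inE xy subnn leqnn /=; exact.
apply: (@le_trans _ _ (mean p (I := I) (fun=> 1))); last by rewrite mean_cst.
rewrite -[leRHS](mean_cond_mean p [set x]); apply: (ler_mean p01) => w.
apply: (le_trans (cond_var_le _ _ _ _)); apply: (ler_cond_mean p01) => w'.
by rewrite /=; case: (w' x); rewrite ?expr1n ?expr0n.
Qed.

Lemma card_unblocked_kids h x z w : z \in kids x ->
  (#|[set y in kids x | ~~ blocked h y w]| =
   #|[set y in kids x :\ z | ~~ blocked h y w]| + ~~ blocked h z w)%N.
Proof.
move=> zx; rewrite (cardsD1 z) !inE addnC; congr (_ + _)%N.
  by apply: eq_card => y; rewrite !inE andbA.
by move: zx; rewrite inE => ->.
Qed.

(* A vertex below the child [z] of [x] can matter only when [x] is occupied and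
   exactly [j.-1] of the other children are not blocked. *)
Lemma influence_kid h x y z : z \in kids x -> y \in subtree z ->
  (0 < lev z)%N -> (lev z + h <= n)%N ->
  mean p (cond_var p [set y] (fun w => (blocked h.+1 x w)%:R)) =
  p * binom_pmf #|kids x|.-1 j.-1 (lam k h) *
    mean p (cond_var p [set y] (fun w => (blocked h z w)%:R)).
Proof.
move=> zx yz z0 zn.
pose N w := #|[set y in kids x :\ z | ~~ blocked h y w]|.
pose P w : R := (w x && (N w == j.-1))%:R.
pose Q w : R := (w x && (N w < j.-1)%N)%:R.
have Nz w w' : N (mix (subtree z) w' w) = N w.
  apply: eq_card => z'; rewrite !inE.
  case: (boolP [&& z' != z, (0 < lev z')%N & par z' == x]) => //= /andP[z'z z'x].
  congr negb; apply: blocked_local => y' y'z'; rewrite ffunE.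
  have := subtree_disjoint (y := z') (z := z) (x := x) (T := T).
  rewrite inE z'x => /(_ isT zx z'z); rewrite disjoint_subset.
  by move=> /fintype.subsetP /(_ _ y'z'); rewrite inE /= => /negbTE ->.
have xz w w' : mix (subtree z) w' w x = w x.
  rewrite ffunE; case: ifP => // /subtree_lev; rewrite (kids_lev zx).
  by rewrite ltnn.
have yz' : [set y] \subset subtree z by rewrite finset.sub1set.
(* With fewer than [j.-1] unblocked siblings the state of [z] is irrelevant ([Q]), with exactly
   [j.-1] it decides ([P]), with more [x] is not blocked. Neither [P] nor [Q] reads the subtree of
   [z]. *)
have PE w : (blocked h.+1 x w)%:R = Q w + P w * (blocked h z w)%:R.
  rewrite /= (card_unblocked_kids _ _ zx) -/(N w) /P /Q.
  case: (w x) => /=; last by rewrite !mul0r addr0.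
  have -> : (N w + ~~ blocked h z w < j)%N =
    (N w < j.-1)%N || ((N w == j.-1) && blocked h z w).
    by case: (blocked h z w) => /=; rewrite ?andbT ?andbF; lia.
  case: (ltngtP (N w) j.-1) => /=; rewrite ?mul0r ?addr0 ?mul1r ?add0r//.
have Pz : indep (subtree z) P by move=> w w'; rewrite /P Nz xz.
have Qz : indep (subtree z) Q by move=> w w'; rewrite /Q Nz xz.
rewrite (@eq_mean _ _ _ _ (fun w => cond_var p [set y] (fun w => (blocked h z w)%:R) w * P w)).
  rewrite (@mean_mul_indep _ _ _ (subtree z))//; last first.
    by apply: indep_cond_varr => w w'; rewrite blocked_mix.
  rewrite mulrC; congr (_ * _).
  rewrite /P (@mean_occ_count _ _ _ T j p h x _ (fun m => m == j.-1)) ?subD1set//; congr (_ * _).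
  rewrite -(_ : #|kids x :\ z| = #|kids x|.-1); last by rewrite (cardsD1 z (kids x)) zx.
  apply: (@mean_count_eq _ _ _ _ _ subtree).
  - move=> z1 z2; rewrite !in_setD1 => /andP[_ ?] /andP[_ ?].
    exact: (@subtree_disjoint _ _ _ x).
  - by move=> z1 w w' _; rewrite blocked_mix.
  - move=> z1; rewrite in_setD1 => /andP[_ z1x]; apply: mean_blocked => //.
      by rewrite (kids_lev z1x).
    by rewrite (kids_lev z1x) -(kids_lev zx).
move=> w; rewrite (eq_cond_var _ _ PE) cond_var_affine; last 2 first.
- exact: indepS Qz.
- exact: indepS Pz.
by rewrite mulrC; congr (_ * _); rewrite /P; case: (_ && _); rewrite ?expr1n ?expr0n.
Qed.

Lemma bottom_influenceS h x : (lev x + h < n)%N ->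
  bottom_influence h.+1 x =
  p * binom_pmf #|kids x|.-1 j.-1 (lam k h) * \sum_(z in kids x) bottom_influence h z.
Proof.
move=> xn; rewrite /bottom_influence big_mkcondr sum_subtree [X in X + _]ifF ?add0r; last first.
  by apply/negbTE; lia.
rewrite mulr_sumr; apply: eq_bigr => z zx; rewrite -big_mkcondr (kids_lev zx).
rewrite mulr_sumr; apply: eq_big => [y|y /andP[yz _]]; first by rewrite addSnnS.
by apply: influence_kid; rewrite // (kids_lev zx).
Qed.

Lemma lam01 h : 0 <= lam k h <= 1.
Proof. exact: blocked_prob01. Qed.

Lemma bottom_influence_ge0 h x : 0 <= bottom_influence h x.
Proof.
apply: sumr_ge0 => y _; apply: mean_ge0 => // w; exact: cond_var_ge0.
Qed.

Context (rho : R) (rhoP : forall h, p * cdf_slope (lam k h) <= rho).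

Lemma rho_ge0 : 0 <= rho.
Proof.
apply: le_trans (rhoP 0); case/andP: p01 => p0 _.
by rewrite mulr_ge0// mulr_ge0// binom_pmf_ge0// lam01.
Qed.

Lemma bottom_influence_le h x : (0 < lev x)%N -> (lev x + h <= n)%N ->
  bottom_influence h x <= rho ^+ h.
Proof.
elim: h x => [|h IH] x x0 xn; first exact: bottom_influence0.
rewrite bottom_influenceS; last by lia.
rewrite card_kids; last by rewrite x0; lia.
have B0 : 0 <= p * binom_pmf k.-1 j.-1 (lam k h).
  by case/andP: p01 => p0 _; rewrite mulr_ge0// binom_pmf_ge0// lam01.
apply: (@le_trans _ _ (p * binom_pmf k.-1 j.-1 (lam k h) * (k%:R * rho ^+ h))).
  rewrite ler_wpM2l//.
  rewrite -(card_kids (x := x)); last by rewrite x0; lia.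
  rewrite mulr_natl -sumr_const; apply: ler_sum => z zx.
  by apply: IH; rewrite (kids_lev zx)//; lia.
rewrite mulrA exprS ler_wpM2r ?exprn_ge0 ?rho_ge0//.
apply: le_trans (rhoP h); rewrite /cdf_slope; lra.
Qed.

(** The number of children of the root may differ from [k], so its own factor is only bounded by 1
    per child. Hence [K] and the loss of one power of [rho]. *)
Lemma bottom_influence_root (K h : nat) : (h.+1 <= n)%N -> (#|kids root| <= K)%N ->
  bottom_influence h.+1 root <= K%:R * rho ^+ h.
Proof.
move=> hn rK; rewrite bottom_influenceS ?lev_root ?add0n//.
have [p0 p1] := andP p01.
have B01 : 0 <= p * binom_pmf #|kids root|.-1 j.-1 (lam k h) <= 1.
  by rewrite mulr_ge0 ?binom_pmf_ge0 ?lam01//= mulr_ile1 ?binom_pmf_ge0 ?binom_pmf_le1 ?lam01.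
case/andP: B01 => B0 B1.
apply: (@le_trans _ _ (\sum_(z in kids root) bottom_influence h z)).
  rewrite -[leRHS]mul1r ler_wpM2r// sumr_ge0// => z _; exact: bottom_influence_ge0.
apply: (@le_trans _ _ (#|kids root|%:R * rho ^+ h)).
  rewrite mulr_natl -sumr_const; apply: ler_sum => z zx.
  by apply: bottom_influence_le; rewrite (kids_lev zx) lev_root.
by rewrite ler_wpM2r ?exprn_ge0 ?rho_ge0// ler_nat.
Qed.

End influence.

(** * Test functions *)

Section upper_bound.
Context (R : realType) (I : finType) (n : nat) (T : finite_tree I n) (j : nat) (p : R).
Local Notation lev := (lev T).
Local Notation par := (par T).
Local Notation root := (root T).
Local Notation kids := (kids T).
Local Notation subtree := (subtree T).
Local Notation blocked := (blocked T j).
Local Notation lam := (blocked_prob j p).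
Implicit Types (w : {ffun I -> bool}) (f : {ffun I -> bool} -> R).
Context (p01 : 0 < p < 1) (j0 : (0 < j)%N).
Context (c : I -> {ffun I -> bool} -> R).
Context (c01 : forall x w, 0 <= c x w <= 1).
Context (c_legal : forall x w, (lev x < n)%N -> c x w != 0 ->
  (j <= #|[set y in kids x | ~~ w y]| + ((0 < lev x)%N && ~~ w (par x)))%N).

Lemma upd_neq w x b y : y != x -> upd w x b y = w y.
Proof. by rewrite ffunE => /negbTE ->. Qed.

Lemma upd_eq w x b : upd w x b x = b.
Proof. by rewrite ffunE eqxx. Qed.

Lemma kids_neq x y : y \in kids x -> y != x.
Proof.
move=> /kids_lev yx; apply: contra_eq_neq yx => ->.
by rewrite -[X in X != _]addn0 -addn1 eqn_add2l.
Qed.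

(* If flipping [x] changes whether [y] is blocked, the constraint at [x] is
   violated in both models: the parent of [x] is occupied too. *)
Lemma blocked_sens h y x w :
  blocked h y (upd w x true) != blocked h y (upd w x false) ->
  (lev x < lev y + h)%N ->
  (#|[set z in kids x | ~~ w z]| < j)%N && ((x == y) || w (par x)).
Proof.
elim: h y => [|h IH] y /=.
  have [->|yx] := eqVneq y x; first by rewrite addn0 ltnn.
  by rewrite !upd_neq// eqxx.
have [-> + _|xy neq lt] := eqVneq x y.
  rewrite !upd_eq /= eqbF_neg negbK andbT; apply: leq_ltn_trans.
  apply: subset_leq_card; apply/fintype.subsetP => z; rewrite !inE => /andP[zy].
  rewrite zy /=; apply: contraNN => /blocked_occ; rewrite upd_neq// kids_neq//.
  by rewrite inE.
have [z zy zneq] : exists2 z, z \in kids y &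
    blocked h z (upd w x true) != blocked h z (upd w x false).
  apply/exists_inP; apply: contraNT neq => /exists_inPn eqz.
  rewrite !(upd_neq _ _ (_ : y != x)) 1?eq_sym//; apply/eqP; congr (_ && (_ < _)%N).
  apply: eq_card => z; rewrite !inE.
  case: (boolP ((0 < lev z)%N && (par z == y))) => //= zy; congr negb.
  by have := eqz z; rewrite inE zy negbK => /(_ isT)/eqP.
have wy : w y.
  by apply: contraNT neq; rewrite !upd_neq 1?eq_sym// => /negbTE ->.
have /andP[-> /orP[/eqP->|->]] := IH z zneq ltac:(rewrite (kids_lev zy); lia).
  by rewrite (kids_par zy) wy orbT.
by rewrite orbT.
Qed.

Local Notation test := (fun w => (blocked n root w)%:R : R).

Lemma inner_dirichlet0 x w : (lev x < n)%N ->
  c x w * cond_var p [set x] test w = 0.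
Proof.
move=> xn; rewrite cond_var1.
have [->|neq] := eqVneq (blocked n root (upd w x true)) (blocked n root (upd w x false)).
  by rewrite subrr expr0n !mulr0.
have /andP[lt px] := blocked_sens neq ltac:(by rewrite lev_root).
have [->|/(c_legal xn) le] := eqVneq (c x w) 0; first by rewrite mul0r.
exfalso; case/orP: px lt le => [/eqP->|->] lt.
  by rewrite lev_root addn0 leqNgt lt.
by rewrite andbF addn0 leqNgt lt.
Qed.

Lemma dirichlet_blocked : dirichlet p c test <= bottom_influence T j p n root.
Proof.
have p01' : 0 <= p <= 1 by case/andP: p01 => *; rewrite !ltW.
rewrite /dirichlet /bottom_influence subtree_root lev_root add0n.
rewrite (bigID (fun y => lev y == n))/= addrC big1 ?add0r => [|x xn]; last first.
  rewrite -[RHS](@mean_cst _ p I); apply: eq_mean => w; apply: inner_dirichlet0.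
  by rewrite ltn_neqAle xn lev_max.
rewrite [leRHS](eq_bigl (fun y => lev y == n)) => [|y]; last by rewrite inE.
apply: ler_sum => y _; apply: ler_mean => // w.
rewrite -[leRHS]mul1r ler_wpM2r ?cond_var_ge0//; by case/andP: (c01 y w).
Qed.

Lemma var_indicator (b : {ffun I -> bool} -> bool) (a : R) :
  mean p (fun w => (b w)%:R) = a ->
  mean p (fun w => ((b w)%:R - a) ^+ 2) = a * (1 - a).
Proof.
move=> ba; rewrite (@eq_mean _ _ _ _ (fun w => (1 - 2 * a) * (b w)%:R + a ^+ 2)).
  by rewrite meanD meanZ ba mean_cst; ring.
by move=> w; case: (b w) => /=; ring.
Qed.

Context (k K : nat) (jk : (j <= k.+1)%N).
Context (card_kids : forall x, (0 < lev x < n)%N -> #|kids x| = k).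
Context (card_root : (#|kids root| <= K)%N).

(** The probability [a] that the root is blocked lies between p s^K and p: it suffices that the root
    is occupied and all its children are blocked, and it is necessary that the root is occupied. *)
Lemma var_blocked h (s : R) : (h < n)%N -> 0 <= s <= lam k h ->
  p * s ^+ K * (1 - p) <= mean p (fun w =>
    ((blocked h.+1 root w)%:R - mean p (fun w => (blocked h.+1 root w)%:R)) ^+ 2).
Proof.
move=> hn /andP[s0 sl]; have /andP[p0 p1] := p01.
have p01' : 0 <= p <= 1 by rewrite !ltW.
have /andP[l0 l1] := blocked_prob01 h p01' jk.
set a := mean p (fun w => (blocked h.+1 root w)%:R); rewrite (@var_indicator _ a)//.
have ap : a <= p.
  rewrite -(mean_occ p root); apply: ler_mean => // w; rewrite ler_nat /=.
  by case: (w root) => //=; case: (_ < _)%N.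
have sa : p * s ^+ K <= a.
  apply: (@le_trans _ _ (p * lam k h ^+ #|kids root|)).
    rewrite ler_pM2l//; apply: (@le_trans _ _ (lam k h ^+ K)).
      exact: lerXn2r.
    exact: ler_wiXn2l.
  rewrite -prodr_const.
  rewrite (eq_bigr (fun z => mean p (fun w => (blocked h z w)%:R))); last first.
    by move=> z zr; rewrite (mean_blocked _ _ (k := k))// (kids_lev zr) lev_root.
  rewrite -(@mean_prod_indep _ _ _ _ _ subtree); first last.
  - by move=> z _ w w'; rewrite blocked_mix.
  - by move=> y z; exact: (@subtree_disjoint _ _ _ root).
  rewrite -{1}(mean_occ p root) -(@mean_mul_indep _ _ _ [set root]); first last.
  - move=> w w' /=; apply: eq_bigr => z zr; congr (_%:R); congr nat_of_bool.
    apply: blocked_local => y yz; rewrite ffunE inE; case: eqP => // yr.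
    by have := subtree_lev yz; rewrite yr (kids_lev zr) ltnn.
  - by move=> w w'; rewrite ffunE !inE eqxx.
  apply: ler_mean => // w.
  case: (boolP [forall z in kids root, blocked h z w]) => [/forall_inP allb|].
    rewrite [blocked _ _ _]/= [X in (X < j)%N](_ : _ = 0%N) ?j0 ?andbT.
      rewrite big1 ?mulr1// => z zr; by rewrite allb.
    apply/eqP; rewrite cards_eq0; apply/eqP/setP => z; rewrite !inE.
    apply/negbTE/negP => /andP[zr]; rewrite allb// inE//.
  rewrite negb_forall_in => /exists_inP[z zr /negbTE bz].
  by rewrite (bigD1 z)//= bz mul0r mulr0.
have : 0 <= p * s ^+ K by rewrite mulr_ge0 ?exprn_ge0// ltW.
nra.
Qed.

Lemma blocked_test h (rho s : R) : n = h.+1 -> 0 < s ->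
  (forall i, p * cdf_slope j k (lam k i) <= rho) -> (forall i, s <= lam k i) ->
  exists f, 0 < mean p (fun w => (f w - mean p f) ^+ 2) /\
  dirichlet p c f / mean p (fun w => (f w - mean p f) ^+ 2) <=
    K%:R * rho ^+ h / (p * s ^+ K * (1 - p)).
Proof.
move=> nh s0 rhoP sl; have /andP[p0 p1] := p01.
have p01' : 0 <= p <= 1 by rewrite !ltW.
exists test; set V := mean _ _.
have V1 : p * s ^+ K * (1 - p) <= V.
  have := @var_blocked h s; rewrite -!nh; apply; first by rewrite nh.
  by rewrite sl ltW.
have V0 : 0 < p * s ^+ K * (1 - p) by rewrite !mulr_gt0 ?exprn_gt0// subr_gt0.
split; first exact: lt_le_trans V1.
rewrite ler_pM ?invr_ge0 ?(le_trans (ltW V0) V1)//.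
- apply: sumr_ge0 => y _; apply: mean_ge0 => // w; case/andP: (c01 y w) => *.
  by rewrite mulr_ge0// cond_var_ge0.
- apply: (le_trans dirichlet_blocked).
  have := @bottom_influence_root _ _ _ T j p p01' j0 k jk card_kids rho rhoP K h.
  by rewrite -nh; apply.
- by rewrite lef_pV2 ?posrE// (lt_le_trans V0).
Qed.

(** Only the flip at the root changes its spin, and there the conditional variance equals the full
    variance, so the quotient is the mean rate. *)
Lemma root_spin_test :
  exists f, 0 < mean p (fun w => (f w - mean p f) ^+ 2) /\
  dirichlet p c f / mean p (fun w => (f w - mean p f) ^+ 2) = mean p (c root).
Proof.
have /andP[p0 p1] := p01.
exists (fun w => (w root)%:R); rewrite mean_occ (@var_indicator (fun w => w root) p (mean_occ p root)).
have V0 : 0 < p * (1 - p) by rewrite mulr_gt0// subr_gt0.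
split=> //; rewrite /dirichlet (bigD1 root)//= big1 ?addr0; last first.
  move=> x xr; rewrite -[RHS](@mean_cst _ p I); apply: eq_mean => w.
  by rewrite cond_var1 !upd_neq 1?eq_sym// subrr expr0n !mulr0.
rewrite (@eq_mean _ _ _ _ (fun w => c root w * (p * (1 - p)))) => [|w].
  by rewrite meanZr mulfK// gt_eqF.
by rewrite cond_var1 !upd_eq subr0 expr1n mulr1.
Qed.

(** The root has no parent, so its rate vanishes when all its children are occupied. *)
Lemma mean_rate_root_le : (0 < n)%N -> mean p (c root) <= 1 - p ^+ K.
Proof.
move=> n0; have /andP[p0 p1] := p01.
have p01' : 0 <= p <= 1 by rewrite !ltW.
apply: (@le_trans _ _ (mean p (fun w => 1 - \prod_(y in kids root) (w y)%:R))).
  apply: ler_mean => // w.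
  case: (boolP [forall z in kids root, w z]) => [/forall_inP allw|].
    rewrite big1 => [|z /allw ->//]; rewrite subrr.
    have [->//|/c_legal] := eqVneq (c root w) 0.
    rewrite lev_root => /(_ n0); rewrite addn0 leqNgt [X in (X < j)%N](_ : _ = 0%N) ?j0//.
    apply/eqP; rewrite cards_eq0; apply/eqP/setP => z; rewrite !inE.
    by apply/negbTE/negP => /andP[zr]; rewrite allw// inE.
  rewrite negb_forall_in => /exists_inP[z zr /negbTE bz].
  by rewrite (bigD1 z)//= bz mul0r subr0; case/andP: (c01 root w).
rewrite meanB mean_cst lerD2l lerN2.
rewrite (mean_prod_in p (kids root) (fun y b => b%:R)).
rewrite (eq_bigr (fun=> p)) => [|y _]; last by rewrite big_bool /bernoulli_pmf /=; ring.
by rewrite prodr_const; apply: ler_wiXn2l => //; exact: ltW.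
Qed.

End upper_bound.

(** * Emptying vertices by legal flips *)

Section emptying.
Context (R : realType) (p : R) (p01 : 0 < p < 1) (I : finType).
Implicit Types (w : {ffun I -> bool}) (f F : {ffun I -> bool} -> R).

(** Serves twice: it bounds the density created by forcing one spin, and it converts a conditional
    variance at one site into a squared difference. *)
Definition flip_cost : R := (p * (1 - p))^-1.

Let pq0 : 0 < p * (1 - p).
Proof. by case/andP: p01 => p0 p1; rewrite mulr_gt0// subr_gt0. Qed.

Let p01' : 0 <= p <= 1.
Proof. by case/andP: p01 => *; rewrite !ltW. Qed.

Lemma flip_cost_ge1 : 1 <= flip_cost.
Proof.
case/andP: p01 => p0 p1; rewrite /flip_cost invf_ge1//; nra.
Qed.

Lemma mean_upd_le F x b : (forall w, 0 <= F w) ->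
  mean p (fun w => F (upd w x b)) <= flip_cost * mean p F.
Proof.
move=> F0; rewrite mulrC ler_pdivlMr// -[leRHS](mean_cond_mean p [set x]) -meanZr.
apply: (ler_mean p01') => w; rewrite cond_mean1 big_bool /bernoulli_pmf /=.
rewrite -!/(upd _ _ _); have := F0 (upd w x true); have := F0 (upd w x false).
case/andP: p01 => p0 p1; set u := F (upd w x true); set v := F (upd w x false) => v0 u0.
have q0 : 0 <= 1 - p by rewrite subr_ge0 ltW.
have pu : 0 <= p * u by rewrite mulr_ge0// ltW.
have qv : 0 <= (1 - p) * v by rewrite mulr_ge0.
have ppu : 0 <= p * (p * u) by rewrite mulr_ge0// ltW.
have qqv : 0 <= (1 - p) * ((1 - p) * v) by rewrite mulr_ge0.
case: b; rewrite -/u -/v; lra.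
Qed.

Lemma mean_sqr_flip f x F : 
  mean p (fun w => F w * (f (upd w x true) - f (upd w x false)) ^+ 2) =
  flip_cost * mean p (fun w => F w * cond_var p [set x] f w).
Proof.
rewrite -meanZ; apply: eq_mean => w; by rewrite cond_var1 /flip_cost [RHS]mulrCA mulKf// gt_eqF.
Qed.

End emptying.

Section emptying_tree.
Context (R : realType) (I : finType) (n : nat) (T : finite_tree I n) (j : nat) (p : R).
Local Notation lev := (lev T).
Local Notation par := (par T).
Local Notation root := (root T).
Local Notation kids := (kids T).
Local Notation subtree := (subtree T).
Local Notation blocked := (blocked T j).
Local Notation kap := (flip_cost p).
Implicit Types (w : {ffun I -> bool}) (f F : {ffun I -> bool} -> R).
Context (p01 : 0 < p < 1) (K : nat).
Context (card_kids : forall x, (#|kids x| <= K)%N).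
Context (c : I -> {ffun I -> bool} -> R).
Context (c01 : forall x w, 0 <= c x w <= 1).
Context (c_kids : forall x w, (j <= #|[set y in kids x | ~~ w y]|)%N -> c x w = 1).

Let p01' : 0 <= p <= 1.
Proof. by case/andP: p01 => *; rewrite !ltW. Qed.

(* The net effect of emptying [z] by legal flips below it, all of which are
   undone afterwards. *)
Definition emptied h z w : {ffun I -> bool} :=
  if blocked h z w then w else upd w z false.

Definition emptied_seq h (s : seq I) w := foldl (fun w z => emptied h z w) w s.

Definition removable h x w : bool :=
  (j <= #|[set y in kids x | ~~ blocked h y w]|)%N.

Lemma emptiedE h z w y : emptied h z w y = if y == z then blocked h z w else w y.
Proof.
rewrite /emptied; case: ifP => bz; last by rewrite ffunE.
by case: eqP => // ->; rewrite (blocked_occ bz).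
Qed.

Lemma emptied_outside h z w y : y != z -> emptied h z w y = w y.
Proof. by move=> /negbTE yz; rewrite emptiedE yz. Qed.

(** Siblings do not interact: whether a child is blocked is read in its own subtree, which emptying
    the others leaves unchanged. *)
Lemma emptied_seqE h x s w y : uniq s -> {subset s <= kids x} ->
  emptied_seq h s w y = if y \in s then blocked h y w else w y.
Proof.
elim: s w => //= z s IH w /andP[zs us] sx.
have zx : z \in kids x by apply: sx; rewrite mem_head.
rewrite IH// => [|y' y's]; last by apply: sx; rewrite inE y's orbT.
rewrite inE; case: ifP => ys.
  have yz : y != z by apply: contraNneq zs => <-.
  rewrite (negbTE yz); apply: blocked_local => v vy; apply: emptied_outside.
  apply: contraTneq vy => ->.
  have yx : y \in kids x by apply: sx; rewrite inE ys orbT.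
  have := subtree_disjoint yx zx yz; rewrite disjoint_sym disjoint_subset.
  by move=> /fintype.subsetP /(_ z (subtree_id T z)).
by rewrite emptiedE orbF; case: eqP => // ->.
Qed.

Lemma mean_emptied_le h z F : (forall w, 0 <= F w) ->
  mean p (fun w => F (emptied h z w)) <= (1 + kap) * mean p F.
Proof.
move=> F0; rewrite mulrDl mul1r; apply: (@le_trans _ _
  (mean p F + mean p (fun w => F (upd w z false)))); last first.
  by rewrite lerD2l mean_upd_le.
rewrite -meanD; apply: ler_mean => // w; rewrite /emptied; case: ifP => _.
  by rewrite lerDl.
by rewrite lerDr.
Qed.

Lemma mean_emptied_seq_le h s F : (forall w, 0 <= F w) ->
  mean p (fun w => F (emptied_seq h s w)) <= (1 + kap) ^+ size s * mean p F.
Proof.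
elim: s F => [|z s IH] F F0 /=; first by rewrite expr0 mul1r.
apply: (le_trans (mean_emptied_le h z (F := fun w => F (emptied_seq h s w)) _)) => //.
rewrite exprS -mulrA ler_wpM2l ?IH//.
by rewrite addr_ge0// (le_trans _ (flip_cost_ge1 p01)).
Qed.

(** Splitting off the first move costs a factor 2 on each side, and the remaining moves start from a
    changed configuration, at the cost 1 + kap. The base is the sum 2 + 2 (1 + kap). *)
Lemma mean_emptied_seq_diff h s f (E : R) :
  (forall z, z \in s -> mean p (fun w => (f w - f (emptied h z w)) ^+ 2) <= E) ->
  0 <= E ->
  mean p (fun w => (f w - f (emptied_seq h s w)) ^+ 2) <=
    E * (4 + 2 * kap) ^+ size s.
Proof.
have k1 := flip_cost_ge1 p01.
elim: s => [|z s IH] zE E0 /=.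
  rewrite expr0 mulr1 (@eq_mean _ _ _ _ (fun=> 0)) ?mean_cst// => w.
  by rewrite subrr expr0n.
have IHs : mean p (fun w => (f w - f (emptied_seq h s w)) ^+ 2) <=
    E * (4 + 2 * kap) ^+ size s.
  by apply: IH => // y ys; apply: zE; rewrite inE ys orbT.
apply: (@le_trans _ _ (2 * mean p (fun w => (f w - f (emptied h z w)) ^+ 2) +
   2 * mean p (fun w => (f (emptied h z w) - f (emptied_seq h s (emptied h z w))) ^+ 2))).
  rewrite -!meanZ -meanD; apply: ler_mean => // w.
  set a := f w; set b := f (emptied _ _ _); set d := f _.
  have := sqr_ge0 (a - 2 * b + d); lra.
have := zE z (mem_head _ _).
have := @mean_emptied_le h z (fun w => (f w - f (emptied_seq h s w)) ^+ 2) (fun=> sqr_ge0 _).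
move: IHs; rewrite exprS.
have : 1 <= (4 + 2 * kap) ^+ size s by rewrite exprn_ege1//; lra.
set X := mean _ _; set Y := mean _ _; set Z := mean _ _; set W := _ ^+ size s.
move=> W1 h1 h2 h3.
have h4 : (1 + kap) * X <= (1 + kap) * (E * W) by rewrite ler_wpM2l//; lra.
have : E <= E * W by rewrite ler_peMr.
nra.
Qed.

(** The 3 comes from the square of a sum of three differences: the flip with the children emptied,
    and the emptying of the children for each of the two values at [x]. The latter two give the
    2. *)
Fixpoint removable_const h : R :=
  if h is h'.+1 then
    3 * ((1 + kap) ^+ K + 2 * kap * removable_const h' * (4 + 2 * kap) ^+ K)
  else 1.

Lemma removable_const_ge0 h : 0 <= removable_const h.
Proof.
have k1 := flip_cost_ge1 p01.
elim: h => //= h IH; rewrite mulr_ge0// addr_ge0 ?mulr_ge0 ?exprn_ge0//; lra.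
Qed.

Lemma dirichlet_term_ge0 f y : 0 <= mean p (fun w => c y w * cond_var p [set y] f w).
Proof.
by apply: mean_ge0 => // w; case/andP: (c01 y w) => *; rewrite mulr_ge0// cond_var_ge0.
Qed.

Lemma dirichlet_term f y :
  mean p (fun w => c y w * cond_var p [set y] f w) <= dirichlet p c f.
Proof.
rewrite /dirichlet (bigD1 y)//= lerDl; apply: sumr_ge0 => z _.
exact: dirichlet_term_ge0.
Qed.

Lemma dirichlet_ge0 f : 0 <= dirichlet p c f.
Proof. by apply: sumr_ge0 => z _; exact: dirichlet_term_ge0. Qed.

(* Empty the children of [x] that are not blocked, flip [x] legally, and restore
   the children: the flip at [x] is a telescoping sum of legal flips. *)
Lemma removable_bound h x f :
  mean p (fun w => (removable h x w)%:R * cond_var p [set x] f w) <=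
    removable_const h * dirichlet p c f.
Proof.
have k1 := flip_cost_ge1 p01.
elim: h x => [|h IH] x.
  rewrite mul1r; apply: le_trans (dirichlet_term f x); apply: ler_mean => // w.
  rewrite ler_wpM2r ?cond_var_ge0//; case: (boolP (removable 0 x w)) => /= rx.
    by rewrite c_kids.
  by case/andP: (c01 x w).
set D := dirichlet _ _ _; have D0 : 0 <= D := dirichlet_ge0 f.
have E0 : 0 <= kap * (removable_const h * D).
  by rewrite !mulr_ge0 ?removable_const_ge0//; lra.
(* Emptying [z] changes the configuration only if [z] is occupied and not blocked; then [z] is
   removable at depth [h] and the induction hypothesis applies to its flip. *)
have one z : mean p (fun w => (f w - f (emptied h.+1 z w)) ^+ 2) <=
    kap * (removable_const h * D).
  apply: (@le_trans _ _ (kap * mean p (fun w => (removable h z w)%:R *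
    cond_var p [set z] f w))); last by rewrite ler_wpM2l// ?IH//; lra.
  rewrite -mean_sqr_flip//; apply: ler_mean => // w.
  rewrite /emptied [blocked _ _ _]/=; case: ifP => [_|bz].
    by rewrite subrr expr0n mulr_ge0// sqr_ge0.
  have [wz|wz] := boolP (w z).
    rewrite wz /= in bz.
    have -> : removable h z w by rewrite /removable leqNgt bz.
    rewrite mul1r (_ : upd w z true = w)//.
    by apply/ffunP => y; rewrite ffunE; case: eqP => // ->.
  have -> : upd w z false = w.
    by apply/ffunP => y; rewrite ffunE; case: eqP => // ->; apply/esym/negbTE.
  by rewrite subrr expr0n mulr_ge0// sqr_ge0.
pose s := enum (kids x).
have sP w y : emptied_seq h.+1 s w y = if y \in kids x then blocked h.+1 y w else w y.
  rewrite (@emptied_seqE h.+1 x) ?enum_uniq ?mem_enum// => y' .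
  by rewrite mem_enum.
have sK : (size s <= K)%N by rewrite -cardE.
have xk y : y \in kids x -> x \notin subtree y.
  by move=> yx; apply/negP => /subtree_lev; rewrite (kids_lev yx) ltnn.
(* Since [x] lies in no subtree of its children, emptying them commutes with setting the spin at
   [x]. *)
have sx w b : emptied_seq h.+1 s (upd w x b) = upd (emptied_seq h.+1 s w) x b.
  apply/ffunP => y; rewrite sP [RHS]ffunE sP; case: ifP => yx; last by rewrite ffunE.
  rewrite (negbTE (kids_neq yx)); apply: blocked_local => v vy.
  by rewrite upd_neq//; apply: contraTneq vy => ->; exact: xk.
pose r w := (f w - f (emptied_seq h.+1 s w)) ^+ 2.
have rE : mean p r <= kap * (removable_const h * D) * (4 + 2 * kap) ^+ K.
  apply: (le_trans (mean_emptied_seq_diff _ E0)) => [z _|]; first exact: one.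
  by rewrite ler_wpM2l// ler_weXn2l//; lra.
pose d w := (f (upd w x true) - f (upd w x false)) ^+ 2.
have main : mean p (fun w => (removable h.+1 x w)%:R * d w) <=
   3 * (mean p (fun w => c x (emptied_seq h.+1 s w) * d (emptied_seq h.+1 s w))
     + mean p (fun w => r (upd w x true)) + mean p (fun w => r (upd w x false))).
  rewrite -!meanD -meanZ; apply: ler_mean => // w.
  have d0 w' : 0 <= d w' by exact: sqr_ge0.
  have r0 w' : 0 <= r w' by exact: sqr_ge0.
  have [rx|_] := boolP (removable h.+1 x w); last first.
    rewrite mul0r mulr_ge0// !addr_ge0// mulr_ge0//.
    by case/andP: (c01 x (emptied_seq h.+1 s w)).
  rewrite c_kids; last first.
    apply: (leq_trans rx); apply: subset_leq_card; apply/fintype.subsetP => y.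
    rewrite !finset.in_set sP => /andP[yx by_].
    by rewrite [y \in kids x]inE yx.
  rewrite !mul1r /d /r !sx.
  set u1 := f (upd w x true); set u2 := f (upd w x false).
  set v1 := f (upd _ x true); set v2 := f (upd _ x false).
  have := sqr_ge0 (v1 - v2 - (u1 - v1)); have := sqr_ge0 (v1 - v2 - (v2 - u2)).
  have := sqr_ge0 (u1 - v1 - (v2 - u2)); lra.
set X := mean p (fun w => _ * cond_var _ _ _ _).
have A : mean p (fun w => c x (emptied_seq h.+1 s w) * d (emptied_seq h.+1 s w)) <=
    kap * ((1 + kap) ^+ K * D).
  apply: (le_trans (@mean_emptied_seq_le h.+1 s (fun w => c x w * d w) _)) => [w|].
    by rewrite mulr_ge0 ?sqr_ge0//; case/andP: (c01 x w).
  rewrite mean_sqr_flip// mulrCA ler_wpM2l//; first lra.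
  apply: ler_pM; rewrite ?exprn_ge0 ?dirichlet_term_ge0 ?dirichlet_term//; first lra.
  by rewrite ler_weXn2l//; lra.
have B b : mean p (fun w => r (upd w x b)) <=
    kap * (kap * (removable_const h * D) * (4 + 2 * kap) ^+ K).
  apply: (le_trans (mean_upd_le p01 x b (F := r) (fun=> sqr_ge0 _))).
  by rewrite ler_wpM2l//; lra.
rewrite -(@ler_pM2l _ kap); last lra.
rewrite -mean_sqr_flip//; apply: (le_trans main).
have := B true; have := B false; rewrite /=; lra.
Qed.

End emptying_tree.

(** * Iteration of the blocking probability *)

Section cdf_analysis.
Context (R : realType) (k j : nat) (j0 : (0 < j)%N) (jk : (j <= k)%N).
Implicit Types (s x : R).

Definition cdf_poly : {poly R} :=
  \sum_(i < j) 'C(k, i)%:R *: ((1 - 'X) ^+ i * 'X^(k - i)).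

Lemma cdf_polyE s : cdf_poly.[s] = binom_cdf k j s.
Proof.
rewrite horner_sum; apply: eq_bigr => i _; rewrite /binom_pmf !hornerE.
by [].
Qed.

(** The derivative of the term of index i is t(i+1) - t(i), so only the boundary term t(j)
    survives. *)
Lemma deriv_cdf_poly s : cdf_poly^`().[s] = cdf_slope j k s.
Proof.
pose t (i : nat) : R := (i * 'C(k, i))%:R * (1 - s) ^+ i.-1 * s ^+ (k - i).
have E : cdf_poly^`().[s] = \sum_(0 <= i < j) (t i.+1 - t i).
  rewrite /cdf_poly raddf_sum horner_sum big_mkord; apply: eq_bigr => i _.
  rewrite /= derivZ derivM derivXn deriv_exp derivB derivX -[in 1^`()]polyC1 derivC.
  rewrite !hornerE !hornerMn !hornerE /t mul_bin_left subnS !natrM /=.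
  rewrite -[_ *+ i]mulr_natr -[_ *+ (k - i)]mulr_natr; ring.
rewrite E telescope_sumr// /t mul0n !mul0r subr0.
have := mul_bin_diag k j.-1; rewrite prednK// => <-.
rewrite /cdf_slope /binom_pmf natrM.
by have -> : (k.-1 - j.-1 = k - j)%N; [lia | ring].
Qed.

Lemma binom_cdf_homo s x : 0 <= s -> s <= x -> x <= 1 -> binom_cdf k j s <= binom_cdf k j x.
Proof.
rewrite -!cdf_polyE => s0; rewrite le_eqVlt => /orP[/eqP->//|sx] x1.
have [y /andP[sy yx] E] := poly_mvt cdf_poly sx.
rewrite -subr_ge0 E mulr_ge0 ?subr_ge0 ?(ltW sx)// deriv_cdf_poly.
rewrite !bnd_simp in sy yx.
by rewrite mulr_ge0// binom_pmf_ge0// (le_trans s0 (ltW sy)) (le_trans (ltW yx)).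
Qed.

(** The quotient psi(x) / x, a polynomial because j <= k. *)
Definition ratio_poly : {poly R} :=
  \sum_(i < j) 'C(k, i)%:R *: ((1 - 'X) ^+ i * 'X^((k - i).-1)).

Lemma ratio_polyE : cdf_poly = 'X * ratio_poly.
Proof.
rewrite mulr_sumr; apply: eq_bigr => i _; rewrite -scalerAr mulrCA -exprS.
by rewrite prednK// subn_gt0 (leq_trans (ltn_ord i) jk).
Qed.

Lemma binom_cdf_ratio x : binom_cdf k j x = x * ratio_poly.[x].
Proof. by rewrite -cdf_polyE ratio_polyE hornerM hornerX. Qed.

(** Makes x psi'(x) / psi(x) a multiple of the ratio of [binom_pmf k j.-1] to [binom_cdf k j], which
    [binom_cdf_pmf] shows to be nonincreasing. *)
Lemma slopeE x : x * cdf_slope j k x = (k - j.-1)%:R * binom_pmf k j.-1 x.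
Proof.
have E : k%:R * 'C(k.-1, j.-1)%:R = (k - j.-1)%:R * 'C(k, j.-1)%:R :> R.
  by rewrite -!natrM mul_bin_down.
have Ex : x ^+ (k - j.-1) = x * x ^+ (k.-1 - j.-1).
  by rewrite -exprS; congr (_ ^+ _); lia.
rewrite /cdf_slope /binom_pmf Ex.
transitivity (k%:R * 'C(k.-1, j.-1)%:R * ((1 - x) ^+ j.-1 * (x * x ^+ (k.-1 - j.-1)))).
  by ring.
by rewrite E; ring.
Qed.

(* Cross-multiplied form of the monotonicity of the likelihood ratios of
   binomial laws. *)
Lemma binom_cdf_pmf s x : 0 <= s -> s <= x -> x <= 1 ->
  binom_cdf k j s * binom_pmf k j.-1 x <= binom_cdf k j x * binom_pmf k j.-1 s.
Proof.
move=> s0 sx x1; rewrite /binom_cdf !mulr_suml; apply: ler_sum => i _.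
have ij : (i <= j.-1)%N by have := ltn_ord i; lia.
rewrite /binom_pmf; set a := 'C(k, i)%:R; set b := 'C(k, j.-1)%:R.
have -> : j.-1 = (i + (j.-1 - i))%N by rewrite subnKC.
have -> : (k - i = (k - (i + (j.-1 - i))) + (j.-1 - i))%N by lia.
set d := (j.-1 - i)%N; set e := (k - _)%N; rewrite !exprD.
have H : (s * (1 - x)) ^+ d <= (x * (1 - s)) ^+ d.
  by apply: lerXn2r; rewrite ?nnegrE; nra.
have c0 : 0 <= a * b * ((1 - s) ^+ i * (1 - x) ^+ i * (s ^+ e * x ^+ e)).
  by rewrite !mulr_ge0 ?exprn_ge0//; lra.
have := ler_wpM2l c0 H; rewrite !exprMn; lra.
Qed.

(** If psi(x) / x has dropped between [s] and [x], its derivative is negative at some y in between,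
    that is y psi'(y) < psi(y). The monotonicity of y psi'(y) / psi(y) carries this over to [x]. *)
Lemma slope_lt s x : 0 < s -> s < x -> x < 1 ->
  binom_cdf k j x / x < binom_cdf k j s / s ->
  x * cdf_slope j k x < binom_cdf k j x.
Proof.
move=> s0 sx x1; have x0 := lt_trans s0 sx.
rewrite !binom_cdf_ratio ![_ * _.[_]]mulrC !mulfK ?gt_eqF// => rlt.
have [y /andP[sy yx] E] := poly_mvt ratio_poly sx.
rewrite !bnd_simp in sy yx.
move: rlt; rewrite -subr_lt0 E pmulr_llt0 ?subr_gt0// => dy.
rewrite mulrC -binom_cdf_ratio.
have y0 := lt_trans s0 sy; have y1 := lt_trans yx x1.
have H : y * cdf_slope j k y < binom_cdf k j y.
  rewrite -deriv_cdf_poly binom_cdf_ratio ratio_polyE derivM derivX !hornerE.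
  have : y * (y * (ratio_poly^`()).[y]) < 0 by rewrite !pmulr_rlt0.
  lra.
have b0 (z : R) : 0 < z -> z < 1 -> 0 < binom_pmf k j.-1 z.
  move=> z0 z1; rewrite !mulr_gt0 ?exprn_gt0 ?subr_gt0// ltr0n bin_gt0; lia.
have := binom_cdf_pmf (ltW y0) (ltW yx) (ltW x1).
rewrite slopeE => L; rewrite slopeE in H.
rewrite -(ltr_pM2r (b0 _ y0 y1)); apply: lt_le_trans L.
by rewrite mulrAC ltr_pM2r// b0.
Qed.

Context (p : R) (p01 : 0 < p < 1).
Local Notation lam := (blocked_prob j p k).

Lemma blocked_prob_le h : 0 <= lam h <= p.
Proof.
have p01' : 0 <= p <= 1 by case/andP: p01 => *; rewrite !ltW.
have /andP[-> _]/= := blocked_prob01 h p01' (leqW jk).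
case: h => //= h; rewrite ger_pMr; last by case/andP: p01.
by case/andP: (binom_cdf01 (blocked_prob01 h p01' (leqW jk)) (leqW jk)).
Qed.

Lemma blocked_prob_decr h : lam h.+1 <= lam h.
Proof.
have /andP[p0 p1] := p01.
elim: h => [|h IH]; first by case/andP: (blocked_prob_le 1).
rewrite [leLHS]/= [leRHS]/= ler_pM2l//; apply: binom_cdf_homo => //.
- by case/andP: (blocked_prob_le h.+1).
- by case/andP: (blocked_prob_le h) => _ /le_trans; apply; exact: ltW.
Qed.

Lemma blocked_prob_ge s h : 0 <= s -> s < p * binom_cdf k j s -> s <= 1 -> s <= lam h.
Proof.
move=> s0 sp s1; have /andP[p0 p1] := p01.
have /andP[c0 c1] : 0 <= binom_cdf k j s <= 1 by apply: binom_cdf01; rewrite ?s0 ?leqW.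
elim: h => [|h IH] /=.
  by apply: ltW; apply: (lt_le_trans sp); rewrite ger_pMr.
apply: ltW; apply: (lt_le_trans sp); rewrite ler_pM2l//; apply: binom_cdf_homo => //.
by case/andP: (blocked_prob_le h) => _ /le_trans; apply; exact: ltW.
Qed.

Lemma cdf_slope_ge0 s : 0 <= s <= 1 -> 0 <= cdf_slope j k s.
Proof. by move=> s01; rewrite mulr_ge0// binom_pmf_ge0. Qed.

(** Here psi(x) / x <= 1 / p < psi(s) / s, so x psi'(x) < psi(x), and multiplying by p gives p x
    psi'(x) < p psi(x) <= x. *)
Lemma slope_lt1 s x : 0 < s -> s < p * binom_cdf k j s -> s <= x -> x <= p ->
  p * binom_cdf k j x <= x -> p * cdf_slope j k x < 1.
Proof.
move=> s0 sp; rewrite le_eqVlt => /orP[/eqP<-|sx xp xx].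
  by move=> _ /(lt_le_trans sp); rewrite ltxx.
have /andP[p0 p1] := p01.
have x0 := lt_trans s0 sx; have x1 := le_lt_trans xp p1.
have : x * cdf_slope j k x < binom_cdf k j x.
  apply: (slope_lt s0 sx x1).
  apply: (@le_lt_trans _ _ p^-1).
    by rewrite ler_pdivrMr// mulrC ler_pdivlMr// mulrC.
  by rewrite ltr_pdivlMr// mulrC ltr_pdivrMr// mulrC.
move=> H; rewrite -(ltr_pM2l x0) mulr1; apply: lt_le_trans xx.
by rewrite mulrCA ltr_pM2l.
Qed.

Local Open Scope classical_set_scope.

Lemma supercritical_slope s : 0 <= s <= 1 -> s < p * binom_cdf k j s ->
  exists t rho : R, [/\ 0 < t, 0 <= rho < 1, forall h, t <= lam h &
    forall h, p * cdf_slope j k (lam h) <= rho].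
Proof.
move=> /andP[s0 s1] sp; have /andP[p0 p1] := p01.
have s_gt0 : 0 < s.
  rewrite lt_neqAle s0 andbT; apply/eqP => s00.
  by move: sp; rewrite -s00 -cdf_polyE ratio_polyE hornerM hornerX mul0r mulr0 ltxx.
(* The slope is below 1 at each point of the orbit, but a uniform bound is needed. The decreasing
   orbit stays in the compact set [S], where the slope attains its maximum. *)
pose S := `[s, p]%classic `&` [set x | p * binom_cdf k j x - x <= 0].
have lamS h : S (lam h).
  split; first by rewrite /= in_itv /= blocked_prob_ge//; case/andP: (blocked_prob_le h).
  by rewrite /= subr_le0; exact: blocked_prob_decr.
have cS : compact S.
  rewrite /S; apply: compact_closedI; first exact: segment_compact.
  rewrite (_ : mkset _ = horner (p *: cdf_poly - 'X) @^-1` [set x | x <= 0]).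
    apply: preimage_closed; last exact: closed_le.
    by move=> x _; exact: continuous_horner.
  by apply/seteqP; split => x /=; rewrite !hornerE cdf_polyE.
have S0 : S !=set0 by exists (lam 0).
have cf : {within S, continuous (fun x => p * cdf_slope j k x)}.
  apply: continuous_subspaceT; rewrite (_ : (fun x => _) = horner (p *: cdf_poly^`())).
    exact: continuous_horner.
  by apply/funext => x; rewrite hornerZ deriv_cdf_poly.
have [c cS' cmax] := compact_EVT_max S0 cS cf.
move: (cS'); rewrite inE => -[]; rewrite /= in_itv /= => /andP[sc cp] cc.
exists s, (p * cdf_slope j k c); split => //.
- apply/andP; split; last by apply: (slope_lt1 s_gt0 sp sc cp); rewrite -subr_le0.
  apply: mulr_ge0; first exact: ltW.
  apply: cdf_slope_ge0; rewrite (le_trans s0 sc) (le_trans cp)//; exact: ltW.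
- by move=> h; exact: blocked_prob_ge.
- by move=> h; apply: cmax; rewrite inE.
Qed.

End cdf_analysis.

(** Each iteration at density [p'] is p' / p times an iteration at density [p], which does not
    increase its argument. *)
Lemma subcritical_blocked_prob (R : realType) (k j : nat) (p p' : R) :
  (j <= k.+1)%N -> 0 < p' < p -> p <= 1 ->
  (forall x : R, 0 <= x <= 1 -> p * binom_cdf k j x <= x) ->
  forall h, blocked_prob j p' k h <= (p' / p) ^+ h.
Proof.
move=> jk /andP[p'0 p'p] p1 sub; have p0 := lt_trans p'0 p'p.
have p'01 : 0 <= p' <= 1 by rewrite ltW// ltW// (lt_le_trans p'p).
elim => [|h IH] /=; first by case/andP: p'01.
have := sub _ (blocked_prob01 h p'01 jk); set c := binom_cdf _ _ _ => cl.
rewrite exprS; apply: (@le_trans _ _ (p' / p * blocked_prob j p' k h)).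
  by rewrite -mulrA ler_pM2l// mulrC ler_pdivlMr// mulrC.
by rewrite ler_wpM2l// divr_ge0// ltW.
Qed.

(** * Balls in trees *)

(* An orientation of the graph of [N] away from [r]; it covers both models, since
   [N x] may or may not contain the parent of [x]. *)
Record rooting (V : countType) (N : V -> {fset V}) (k : nat) (r : V) := Rooting {
  vlev : V -> nat;
  vpar : V -> V;
  vlev_eq0 : forall x, (vlev x == 0%N) = (x == r);
  vlev_par : forall x, vlev (vpar x) = (vlev x).-1;
  vpar_mem : forall x, (0 < vlev x)%N -> x \in N (vpar x);
  vnbh : forall x y, y \in N x ->
    (vlev y = (vlev x).+1 /\ vpar y = x) \/ ((0 < vlev x)%N /\ y = vpar x);
  vcard : forall x, (0 < vlev x)%N -> #|` [fset y in N x | (vlev x < vlev y)%N]%fset| = k;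
  vcard_root : (k <= #|` [fset y in N r | (vlev r < vlev y)%N]%fset| <= k.+1)%N }.

Lemma extend0_val (V : countType) (T : {fset V}) (h : {ffun T -> bool}) (x : T) :
  extend0 h (val x) = h x.
Proof. by rewrite /extend0 valK. Qed.

Section ball.
Local Open Scope fset_scope.
Context (V : countType) (N : V -> {fset V}) (k : nat) (r : V) (D : rooting N k r) (n : nat).
Local Notation vlev := (vlev D).
Local Notation vpar := (vpar D).

Lemma in_graph_ball m v : (v \in graph_ball N r m) = (vlev v <= m)%N.
Proof.
elim: m v => [|m IH] v /=; first by rewrite inE leqn0 vlev_eq0.
rewrite inE IH; apply/orP/idP => [[/leqW//|/bigfcupP[y]]|].
  rewrite andbT IH => ym /(vnbh D) [[-> _]|[_ ->]]; first by [].
  by rewrite vlev_par; lia.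
rewrite leq_eqVlt ltnS => /orP[/eqP vm|]; last by left.
right; apply/bigfcupP; exists (vpar v); last by apply: vpar_mem; rewrite vm.
by rewrite IH vlev_par vm /= leqnn.
Qed.

Local Notation T := (graph_ball N r n).

Let tlev (x : T) := vlev (val x).
(** The default value of [insubd] is never taken: the parent of a vertex of the ball is in the ball,
    by [val_tpar]. *)
Let tpar (x : T) : T := insubd x (vpar (val x)).

Lemma tlev_le (x : T) : (tlev x <= n)%N.
Proof. by rewrite /tlev -in_graph_ball; exact: valP. Qed.

Lemma val_tpar (x : T) : val (tpar x) = vpar (val x).
Proof.
rewrite /tpar insubdK// in_graph_ball vlev_par (leq_trans (leq_pred _))//.
exact: tlev_le.
Qed.

Lemma root_in_ball : r \in T.
Proof. by rewrite in_graph_ball (eqP (_ : vlev r == 0%N)) ?vlev_eq0. Qed.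

Definition ball_tree : finite_tree T n.
Proof.
apply: (@FiniteTree T n tlev tpar [` root_in_ball]).
- by move=> x; rewrite /tlev val_tpar vlev_par.
- by rewrite /tlev /=; apply/eqP; rewrite vlev_eq0.
- by move=> x /eqP; rewrite /tlev vlev_eq0 => /eqP xr; apply: val_inj.
- exact: tlev_le.
Defined.

Local Notation kids := (kids ball_tree).

Definition vkids v := [fset y in N v | (vlev v < vlev y)%N].

Lemma mem_kids (x y : T) : (y \in kids x) = (val y \in vkids (val x)).
Proof.
rewrite inE /= !inE /=; apply/andP/andP.
  move=> [y0 /eqP yx]; have E : vpar (val y) = val x by rewrite -yx val_tpar.
  rewrite -E; split; first exact: vpar_mem.
  by rewrite vlev_par ltn_predL.
case=> /(vnbh D) [[E1 E2] _|[x0 ->]].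
  split; first by rewrite /tlev E1.
  by apply/eqP/val_inj; rewrite val_tpar.
by rewrite vlev_par ltnNge leq_pred.
Qed.

Lemma vkids_in_ball v y : (vlev v < n)%N -> y \in vkids v -> y \in T.
Proof.
move=> vn; rewrite !inE in_graph_ball => /andP[/(vnbh D) [[-> _]//|[v0 ->]]].
by rewrite vlev_par ltnNge leq_pred.
Qed.

Lemma card_kidsE (x : T) : (vlev (val x) < n)%N -> #|kids x| = #|` vkids (val x)|.
Proof.
move=> xn; rewrite cardE -(size_map val); apply: perm_size; apply: uniq_perm.
- by rewrite map_inj_uniq ?enum_uniq//; exact: val_inj.
- exact: fset_uniq.
move=> y; apply/mapP/idP => [[z]|yx].
  by rewrite mem_enum mem_kids => zx ->.
exists [` vkids_in_ball xn yx] => //.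
by rewrite mem_enum mem_kids.
Qed.

Lemma card_vkids v : (k <= #|` vkids v| <= k.+1)%N.
Proof.
have [v0|] := ltnP 0 (vlev v); first by rewrite /vkids vcard// leqnn leqnSn.
by rewrite leqn0 vlev_eq0 => /eqP ->; exact: vcard_root.
Qed.

Lemma card_kids_le (x : T) : (#|kids x| <= k.+1)%N.
Proof.
have [xn|xn] := ltnP (vlev (val x)) n.
  by rewrite card_kidsE//; case/andP: (card_vkids (val x)).
rewrite (_ : kids x = finset.set0) ?cards0//; apply/setP => y; rewrite finset.in_set0.
apply/negP => /kids_lev /= yx; have := tlev_le y; rewrite yx.
by rewrite leqNgt ltnS xn.
Qed.

Lemma card_kids_inner (x : T) : (0 < lev ball_tree x < n)%N -> #|kids x| = k.
Proof. by case/andP=> x0 xn; rewrite card_kidsE// /vkids vcard. Qed.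

Implicit Types h : {ffun T -> bool}.

Definition nb_empty h (x : T) := (\sum_(y <- N (val x)) (1 - extend0 h y))%N.

Lemma extend0_out h v : v \notin T -> extend0 h v = false.
Proof. by move=> vT; rewrite /extend0 insubN. Qed.

Lemma nb_emptyE h x : nb_empty h x = size [seq y <- N (val x) | ~~ extend0 h y].
Proof.
rewrite size_filter -sum1_count big_mkcond; apply: eq_bigr => y _.
by case: (extend0 h y).
Qed.

Lemma empty_kids_le h x : (#|[set y in kids x | ~~ h y]%SET| <= nb_empty h x)%N.
Proof.
rewrite nb_emptyE cardE -(size_map val); apply: uniq_leq_size.
  by rewrite map_inj_uniq ?enum_uniq//; exact: val_inj.
move=> y /mapP[z]; rewrite mem_enum finset.in_set mem_kids !inE => /andP[/andP[zx _] hz] ->.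
by rewrite mem_filter extend0_val hz.
Qed.

Lemma nb_empty_bottom h x : vlev (val x) = n -> (k <= nb_empty h x)%N.
Proof.
move=> xn; case/andP: (card_vkids (val x)) => /leq_trans + _; apply.
rewrite nb_emptyE; apply: uniq_leq_size; first exact: fset_uniq.
move=> y; rewrite !inE mem_filter => /andP[yx xy]; rewrite yx andbT extend0_out//.
by rewrite in_graph_ball -ltnNge -xn.
Qed.

Lemma nb_empty_le h x : (vlev (val x) < n)%N ->
  (nb_empty h x <= #|[set y in kids x | ~~ h y]%SET| +
     ((0 < lev ball_tree x)%N && ~~ h (par ball_tree x)))%N.
Proof.
move=> xn; rewrite nb_emptyE cardE -(size_map val).
set b := (_ && _); pose s := if b then [:: vpar (val x)] else [::].
rewrite (_ : nat_of_bool b = size s); last by rewrite /s; case: (b).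
rewrite -size_cat; apply: uniq_leq_size; first by rewrite filter_uniq// fset_uniq.
move=> y; rewrite mem_filter mem_cat => /andP[hy yx].
have := vnbh D yx => -[[E1 E2]|[x0 yE]].
  have yk : y \in vkids (val x) by rewrite !inE yx E1 leqnn.
  apply/orP; left; apply/mapP; exists [` vkids_in_ball xn yk] => //.
  by rewrite mem_enum finset.in_set mem_kids yk -(extend0_val h).
apply/orP; right; rewrite /s /b [lev _ _]/= x0 /=.
rewrite yE -val_tpar extend0_val in hy.
by rewrite hy yE mem_head.
Qed.

Context (j : nat) (jk : (j <= k)%N) (R : realType).
Implicit Types f : {ffun T -> bool} -> R.

Definition ball_rate (x : T) h : R := rate R N j (extend0 h) (val x).

Lemma ball_rateE x h : ball_rate x h = (j <= nb_empty h x)%N%:R.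
Proof. by []. Qed.

Lemma ball_rate01 x h : 0 <= ball_rate x h <= 1.
Proof. by rewrite ball_rateE; case: (_ <= _)%N; rewrite ?lexx ?ler01. Qed.

Lemma ball_rate_kids x h :
  (j <= #|[set y in kids x | ~~ h y]%SET|)%N -> ball_rate x h = 1.
Proof. by move=> jx; rewrite ball_rateE (leq_trans jx)// empty_kids_le. Qed.

Lemma ball_rate_legal x h : (lev ball_tree x < n)%N -> ball_rate x h != 0 ->
  (j <= #|[set y in kids x | ~~ h y]%SET| +
     ((0 < lev ball_tree x)%N && ~~ h (par ball_tree x)))%N.
Proof.
move=> xn; rewrite ball_rateE; rewrite pnatr_eq0 eqb0 negbK => jx.
by apply: (leq_trans jx); exact: nb_empty_le.
Qed.

(** Inside, [x] has at least k >= j children, all empty; at the bottom, at least k neighbours lie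
    outside the ball and are empty by the boundary condition. *)
Lemma ball_rate_free x h : free_kids ball_tree R x h <= ball_rate x h.
Proof.
have [/forall_inP all0|] := boolP [forall y in kids x, ~~ h y]; last first.
  rewrite negb_forall_in => /exists_inP[y yx hy].
  rewrite /free_kids (bigD1 y)//= (negbTE hy) mul0r.
  by case/andP: (ball_rate01 x h).
rewrite /free_kids big1 => [|y yx]; last by rewrite all0.
rewrite ball_rateE; have [xn|xn] := ltnP (vlev (val x)) n; last first.
  rewrite (leq_trans jk)// nb_empty_bottom//; apply/eqP.
  by rewrite eqn_leq xn andbT -in_graph_ball; exact: valP.
rewrite (leq_trans _ (empty_kids_le h x))//.
have -> : [set y in kids x | ~~ h y]%SET = kids x.
  by apply/setP => y; rewrite finset.in_set; apply: andb_idr => /all0.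
rewrite card_kidsE// (leq_trans jk)//; by case/andP: (card_vkids (val x)).
Qed.

(** No vertex is its own neighbour, since levels of neighbours differ. *)
Lemma ball_rate_indep x : indep [set x]%SET (ball_rate x).
Proof.
move=> h h'; congr (_ <= _)%N%:R; rewrite big_seq [RHS]big_seq.
apply: eq_bigr => y yx; congr (1 - nat_of_bool _)%N.
rewrite /extend0; case: insubP => // z _ zy; rewrite ffunE inE; case: eqP => // zx.
move: yx; rewrite -zy zx => /(vnbh D) [[E _]|[x0 E]]; first by case: (n_Sn _ E).
by have := ltn_predL (vlev (val x)); rewrite x0 -(vlev_par D) -E ltnn.
Qed.

Context (p : R).

Lemma fin_dirichletE f :
  fin_mean p (fun h => f h * - fin_generator N j p f h) = dirichlet p ball_rate f.
Proof.
rewrite /dirichlet; under eq_bigr do rewrite -(mean_dirichlet _ _ (@ball_rate_indep _)).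
rewrite -mean_sum; apply: eq_mean => h; rewrite -mulr_sumr; congr (_ * _).
rewrite /fin_generator -sumrN; apply: eq_bigr => x _; rewrite -mulrN opprB.
by rewrite cond_mean1.
Qed.

Lemma fin_varE f : fin_var p f = mean p (fun h => (f h - mean p f) ^+ 2).
Proof. by []. Qed.

Context (p01 : 0 < p < 1).

Lemma fin_var_gt0 f : ~ (exists a : R, forall h, f h = a) -> 0 < fin_var p f.
Proof.
move=> fnc; have [p0 p1] := andP p01.
have w0 h : 0 < weight p h.
  by apply: prodr_gt0 => x _; rewrite /bernoulli_pmf; case: (h x) => //; rewrite subr_gt0.
rewrite fin_varE lt_neqAle mean_ge0 ?andbT; last first.
  by move=> h; exact: sqr_ge0.
  by rewrite !ltW.
apply/eqP => /esym/eqP; rewrite psumr_eq0 => [|h _]; last first.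
  by rewrite mulr_ge0 ?sqr_ge0// ltW.
move=> /allP V0; apply: fnc; exists (mean p f) => h.
apply/eqP; rewrite -subr_eq0; have := V0 h; rewrite mem_index_enum => /(_ isT).
by rewrite mulf_eq0 (gt_eqF (w0 h)) sqrf_eq0.
Qed.

Lemma ball_gap_ge : (block_const p k.+1 ^+ n)^-1 <= gap N j p T.
Proof.
have C0 : 0 < block_const p k.+1 ^+ n.
  by rewrite exprn_gt0// (lt_trans ltr01)// block_const_gt1.
apply: lb_le_inf.
  (* A nonconstant function, so that the infimum is over a nonempty set. *)
  pose f (h : {ffun T -> bool}) : R := (h [` root_in_ball])%:R.
  exists (fin_mean p (fun h => f h * - fin_generator N j p f h) / fin_var p f).
  exists f => //= -[a fa].
  have := fa [ffun=> true]; have := fa [ffun=> false].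
  rewrite /f !ffunE => <- /eqP; by rewrite oner_eq0.
move=> _ [f /= fnc <-]; have V0 := fin_var_gt0 fnc.
rewrite ler_pdivlMr// mulrC ler_pdivrMr// mulrC fin_dirichletE fin_varE.
exact: (tree_poincare p01 card_kids_le ball_rate_free).
Qed.

Lemma ball_gap_le f : 0 < fin_var p f ->
  gap N j p T <= dirichlet p ball_rate f / fin_var p f.
Proof.
move=> V0; have p01' : 0 <= p <= 1 by case/andP: p01 => *; rewrite !ltW.
apply: ge_inf; last first.
  exists f; last by rewrite fin_dirichletE.
  move=> [a fa]; move: V0; rewrite fin_varE (@eq_mean _ _ _ _ (fun=> 0)) => [|h].
    by rewrite mean_cst ltxx.
  rewrite (eq_mean _ (g := fun=> a))// mean_cst fa subrr expr0n//.
exists 0 => _ [g _ <-]; rewrite fin_dirichletE divr_ge0//.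
  apply: sumr_ge0 => x _; apply: mean_ge0 => // h.
  by rewrite mulr_ge0 ?cond_var_ge0//; case/andP: (ball_rate01 x h).
by apply: mean_ge0 => // h; exact: sqr_ge0.
Qed.

Context (j0 : (0 < j)%N).

Lemma ball_gap_le_rate : gap N j p T <= mean p (ball_rate [` root_in_ball]).
Proof.
have [f [V0 E]] := root_spin_test ball_tree p01 ball_rate.
by rewrite -[leRHS]E; exact: ball_gap_le V0.
Qed.

Lemma ball_gap_le1 : gap N j p T <= 1.
Proof.
apply: (le_trans ball_gap_le_rate); rewrite -(@mean_cst _ p T 1).
apply: ler_mean => [|h]; first by case/andP: p01 => *; rewrite !ltW.
by case/andP: (ball_rate01 [` root_in_ball] h).
Qed.

Lemma ball_gap_le_spin : (0 < n)%N -> gap N j p T <= 1 - p ^+ k.+1.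
Proof.
move=> n0; apply: (le_trans ball_gap_le_rate).
exact: (mean_rate_root_le p01 j0 ball_rate01 ball_rate_legal (card_kids_le _) n0).
Qed.

Lemma ball_gap_le_blocked (h : nat) (t rho : R) : n = h.+1 -> 0 < t ->
  (forall i, p * cdf_slope j k (blocked_prob j p k i) <= rho) ->
  (forall i, t <= blocked_prob j p k i) ->
  gap N j p T <= k.+1%:R * rho ^+ h / (p * t ^+ k.+1 * (1 - p)).
Proof.
move=> nh t0 rhoP tP.
have [f [V0 le]] := blocked_test p01 j0 ball_rate01 ball_rate_legal (leqW jk)
  card_kids_inner (card_kids_le _) nh t0 rhoP tP.
exact: le_trans (ball_gap_le V0) le.
Qed.

End ball.

(** * Infinite volume *)

Section local_functions.
Local Open Scope classical_set_scope.
Context (R : realType) (V : countType).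
Implicit Types (w : config V) (u v : config V -> R) (A T : {fset V}).

Definition local_on A u :=
  forall w w' : config V, (forall x, x \in A -> w x = w' x) -> u w = u w'.

Definition restr T w : {ffun T -> bool} := [ffun x => w (val x)].

(** Transfers [u] to configurations on [T]; the values given outside [T] do not matter when [u] is
    local on [T]. *)
Definition hat T u (h : {ffun T -> bool}) : R := u (extend0 h).

Lemma extend0_restr T w x : x \in T -> extend0 (restr T w) x = w x.
Proof. by move=> xT; rewrite /extend0 insubT ffunE. Qed.

Lemma hat_restr T u w : local_on T u -> hat u (restr T w) = u w.
Proof. by move=> uT; apply: uT => x xT; rewrite extend0_restr. Qed.

Lemma local_onS A T u : (A `<=` T)%fset -> local_on A u -> local_on T u.
Proof. by move=> /fsubsetP AT uA w w' ww'; apply: uA => x /AT /ww'. Qed.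

Lemma local_on_comp2 A (g : R -> R -> R) u v : local_on A u -> local_on A v ->
  local_on A (fun w => g (u w) (v w)).
Proof. by move=> uA vA w w' ww'; rewrite (uA _ _ ww') (vA _ _ ww'). Qed.

Lemma local_on_comp A (g : R -> R) u : local_on A u -> local_on A (fun w => g (u w)).
Proof. by move=> uA w w' ww'; rewrite (uA _ _ ww'). Qed.

Lemma measurable_cylinder A (a : V -> bool) : measurable (cylinder A a).
Proof.
rewrite (_ : cylinder A a = \bigcap_(x in [set` A]) [set w | w x = a x]) //.
apply: fin_bigcap_measurable; first exact: finite_fset.
by move=> x _; apply: sub_sigma_algebra; exists x, (a x).
Qed.

Lemma local_sum T u w : local_on T u ->
  u w = \sum_(h : {ffun T -> bool}) hat u h * \1_(cylinder T (extend0 h)) w.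
Proof.
move=> uT; rewrite (bigD1 (restr T w))//= big1 ?addr0.
  rewrite indicE mem_set ?mulr1 ?hat_restr// => x xT.
  by rewrite extend0_restr.
move=> h hw; rewrite indicE memNset ?mulr0// => wh.
case/eqP: hw; apply/ffunP => x; rewrite ffunE.
by rewrite (wh _ (fsvalP x)) extend0_val.
Qed.

Lemma measurable_local T u : local_on T u -> measurable_fun setT u.
Proof.
move=> uT; rewrite (_ : u = fun w =>
    \sum_(h : {ffun T -> bool}) hat u h * \1_(cylinder T (extend0 h)) w); last first.
  by apply/funext => w; exact: local_sum.
apply: measurable_sum => h; apply: measurable_funM => //.
apply: measurable_indic; exact: measurable_cylinder.
Qed.

Context (p : R) (p01 : 0 <= p <= 1).
Local Notation mu := (product_measure V p).

Lemma integral_local T u : local_on T u -> (forall w, 0 <= u w) ->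
  (\int[mu]_w (u w)%:E = (mean p (hat (T := T) u))%:E)%E.
Proof.
move=> uT u0.
under eq_integral => w _ do rewrite (local_sum _ uT) -sumEFin.
have mi (h : {ffun T -> bool}) : measurable_fun setT (fun w : config V =>
    (\1_(cylinder T (extend0 h)) w : R)).
  apply: measurable_indic; exact: measurable_cylinder.
rewrite ge0_integral_sum//=; last 2 first.
- by move=> h; apply/measurable_EFinP; exact: measurable_funM.
- by move=> h w _; rewrite lee_fin mulr_ge0// u0.
rewrite /mean -sumEFin; apply: eq_bigr => h _.
under eq_integral do rewrite EFinM.
rewrite ge0_integralZl_EFin ?u0//; last exact/measurable_EFinP.
rewrite integral_indic//; last exact: measurable_cylinder.
rewrite setIT [X in (_ * X)%E](product_measureP p01) -EFinM mulrC; congr (_ * _)%:E.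
rewrite big_seq_fsetE /=; apply: eq_bigr => x _; congr bernoulli_pmf.
by rewrite extend0_val.
Qed.

(** Extended-valued, so that the triangle-type bounds below require measurability only. *)
Definition sqnorm u : \bar R := (\int[mu]_w (u w ^+ 2)%:E)%E.

Lemma sqnorm_local T u : local_on T u ->
  sqnorm u = (mean p (fun h => hat (T := T) u h ^+ 2))%:E.
Proof.
move=> uT; rewrite /sqnorm (@integral_local T (fun w => u w ^+ 2))//.
  exact: (@local_on_comp T (fun x => x ^+ 2)).
by move=> w; exact: sqr_ge0.
Qed.

Lemma sqnormD u v : measurable_fun setT u -> measurable_fun setT v ->
  (sqnorm (fun w => u w + v w)%R <= 2%:E * sqnorm u + 2%:E * sqnorm v)%E.
Proof.
move=> mu_ mv.
have m2 (f : config V -> R) : measurable_fun setT f ->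
    measurable_fun setT (fun w => (f w ^+ 2)%:E).
  by move=> mf; apply/measurable_EFinP; exact: measurable_funX.
rewrite /sqnorm -!ge0_integralZl_EFin//; last 4 first.
- by move=> w _; rewrite lee_fin sqr_ge0.
- exact: m2.
- by move=> w _; rewrite lee_fin sqr_ge0.
- exact: m2.
rewrite -ge0_integralD//; last 4 first.
- by move=> w _; rewrite mule_ge0// lee_fin sqr_ge0.
- by apply: emeasurable_funM => //; exact: m2.
- by move=> w _; rewrite mule_ge0// lee_fin sqr_ge0.
- by apply: emeasurable_funM => //; exact: m2.
apply: ge0_le_integral => //.
- by move=> w _; rewrite lee_fin sqr_ge0.
- by apply: m2; exact: measurable_funD.
- by apply: emeasurable_funD; apply: emeasurable_funM => //; exact: m2.
move=> w _; rewrite -!EFinM -EFinD lee_fin.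
have := sqr_ge0 (u w - v w); lra.
Qed.

Lemma sqnormB u v (t : config V -> R) : measurable_fun setT u -> measurable_fun setT v ->
  measurable_fun setT t ->
  (sqnorm (fun w => u w - v w)%R <=
    2%:E * sqnorm (fun w => u w - t w)%R + 2%:E * sqnorm (fun w => v w - t w)%R)%E.
Proof.
move=> mu_ mv mt.
have := @sqnormD (fun w => u w - t w) (fun w => t w - v w).
rewrite (_ : sqnorm (fun w => t w - v w) = sqnorm (fun w => v w - t w)); last first.
  by apply: eq_integral => w _; rewrite -sqrrN opprB.
rewrite (_ : sqnorm (fun w => _ + _) = sqnorm (fun w => u w - v w)); last first.
  by apply: eq_integral => w _; rewrite addrA subrK.
apply; exact: measurable_funB.
Qed.

Lemma cvg_L2P (u : nat -> config V -> R) v : cvg_L2 p u v ->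
  forall e : R, 0 < e -> exists n0, forall n, (n0 <= n)%N ->
    (sqnorm (fun w => u n w - v w)%R <= e%:E)%E.
Proof.
move=> uv e e0.
have : nbhs (0%E : \bar R) [set x | (x < (Num.sqrt e)%:E)%E].
  apply: open_nbhs_nbhs; split; first exact: open_ereal_lt_ereal.
  by rewrite /= lte_fin sqrtr_gt0.
move=> /uv[n0 _ H]; exists n0 => n /H /= lt.
have -> : sqnorm (fun w => u n w - v w) = ('N[mu]_(2%:E)[EFin \o (u n \- v)%R] `^ 2)%E.
  rewrite poweR_Lnorm//; apply: eq_integral => w _ /=.
  by rewrite powR_mulrn// real_normK// num_real.
rewrite -[e](sqr_sqrtr (ltW e0)) -powR_mulrn ?sqrtr_ge0// -poweR_EFin.
apply: (@gt0_ler_poweR R 2 (ler0n R 2)); last exact: ltW.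
- by rewrite in_itv /= Lnorm_ge0 leey.
- by rewrite in_itv /= leey lee_fin sqrtr_ge0.
Qed.

End local_functions.

(** * Energies of single flips of local functions *)

Section energy.
Local Open Scope classical_set_scope.
Context (R : realType) (V : countType) (N : V -> {fset V}) (k j : nat).
Context (D : forall x, rooting N k x) (jk : (j <= k)%N).
Context (p : R) (p01 : 0 < p < 1).
Implicit Types (u v : config V -> R) (A T : {fset V}).

Let p01' : 0 <= p <= 1.
Proof. by case/andP: p01 => *; rewrite !ltW. Qed.

Lemma sub_graph_ball x A : exists m, forall n, (m <= n)%N -> (A `<=` graph_ball N x n)%fset.
Proof.
exists (\max_(y <- A) vlev (D x) y)%N => n mn; apply/fsubsetP => y yA.
rewrite (in_graph_ball (D x)); apply: leq_trans mn.
by rewrite (big_rem y)//= leq_maxl.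
Qed.

Definition nbhd A : {fset V} := (A `|` \bigcup_(x <- A) N x)%fset.

Lemma nbhdP A x y : x \in A -> y \in N x -> y \in nbhd A.
Proof. by move=> xA yx; rewrite inE; apply/orP; right; apply/bigfcupP; exists x => //; rewrite xA. Qed.

Lemma sub_nbhd A : (A `<=` nbhd A)%fset.
Proof. exact: fsubsetUl. Qed.

Lemma site_mean_out A u x (w : config V) : local_on A u -> x \notin A -> site_mean p x u w = u w.
Proof.
move=> uA xA; rewrite /site_mean (eq_bigr (fun b => bernoulli_pmf p b * u w)).
  by rewrite -mulr_suml sum_bernoulli mul1r.
move=> b _; congr (_ * _); apply: uA => y yA; rewrite /set_at.
by case: eqP => // yx; rewrite -yx yA in xA.
Qed.

Lemma extend0_upd T (h : {ffun T -> bool}) (x : T) b y : y \in T ->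
  extend0 (upd h x b) y = set_at (extend0 h) (val x) b y.
Proof.
move=> yT; rewrite -[y]/(val [` yT]%fset) /set_at !extend0_val ffunE.
by rewrite -(inj_eq val_inj).
Qed.

Lemma hat_upd T u (h : {ffun T -> bool}) (x : T) b : local_on T u ->
  hat u (upd h x b) = u (set_at (extend0 h) (val x) b).
Proof. by move=> uT; apply: uT => y yT; exact: extend0_upd. Qed.

(** Sites outside [A] contribute nothing, and the rates at sites of [A] read only vertices of [T],
    so the empty boundary condition is not seen. *)
Lemma generator_hat A T u (w : config V) : local_on A u -> (nbhd A `<=` T)%fset ->
  generator N j p u w = fin_generator N j p (hat (T := T) u) (restr T w).
Proof.
move=> uA AT; have uT : local_on T u.
  by apply: local_onS uA; apply: fsubset_trans AT; exact: sub_nbhd.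
rewrite /generator (@fsbigTE _ _ _ _ T) => [|x xT]; last first.
  rewrite (site_mean_out _ uA) ?subrr ?mulr0//; apply: contra xT => xA.
  by apply: (fsubsetP AT); apply: (fsubsetP (sub_nbhd A)).
rewrite big_seq_fsetE; apply: eq_bigr => x _ /=.
have E : fin_site_mean p x (hat (T := T) u) (restr T w) = site_mean p (val x) u w.
  apply: eq_bigr => b _; congr (_ * _); rewrite -/(upd _ _ _) hat_upd//.
  by apply: uT => y yT; rewrite /set_at extend0_restr.
rewrite E hat_restr//; have [xA|xA] := boolP (val x \in A); last first.
  by rewrite (site_mean_out _ uA xA) subrr !mulr0.
congr (_ * _); congr (_ <= _)%N%:R; rewrite big_seq [RHS]big_seq.
apply: eq_bigr => y yx; rewrite extend0_restr//.
by apply: (fsubsetP AT); exact: nbhdP yx.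
Qed.

Lemma local_generator A u : local_on A u -> local_on (nbhd A) (generator N j p u).
Proof.
move=> uA w w' ww'; rewrite !(generator_hat _ uA (fsubset_refl _)).
by congr fin_generator; apply/ffunP => x; rewrite !ffunE ww'//; exact: fsvalP.
Qed.

Lemma sqnorm_generator A T u : local_on A u -> (nbhd A `<=` T)%fset ->
  sqnorm p (generator N j p u) =
  (mean p (fun h : {ffun T -> bool} => fin_generator N j p (hat u) h ^+ 2))%:E.
Proof.
move=> uA AT; rewrite (@sqnorm_local _ _ _ p01' T); last first.
  exact: local_onS AT (local_generator uA).
congr EFin; apply: eq_mean => h; congr (_ ^+ 2).
rewrite /hat (generator_hat _ uA AT); congr fin_generator.
by apply/ffunP => x; rewrite ffunE extend0_val.
Qed.

(** Stated in infinite volume, so that one quantity is computed in the ball around [x] in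
    [flip_energy_le] and in a set common to all sites in [sqnorm_center]. *)
Definition flip_energy x u : R :=
  fine (\int[product_measure V p]_w
    (p * (1 - p) * (u (set_at w x true) - u (set_at w x false)) ^+ 2)%:E)%E.

Lemma local_set_at A u x b : local_on A u -> local_on A (fun w => u (set_at w x b)).
Proof.
move=> uA w w' ww'; apply: uA => y yA; rewrite /set_at; case: ifP => // _.
exact: ww'.
Qed.

Lemma flip_energyE T u (x : T) : local_on T u ->
  flip_energy (val x) u = mean p (cond_var p [set x]%SET (hat (T := T) u)).
Proof.
move=> uT; rewrite /flip_energy (@integral_local _ _ _ p01' T
  (fun w => p * (1 - p) * (u (set_at w (val x) true) - u (set_at w (val x) false)) ^+ 2)).
- by apply: eq_mean => h; rewrite cond_var1 !hat_upd.
- apply: (@local_on_comp2 _ _ T (fun a b => p * (1 - p) * (a - b) ^+ 2));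
    exact: local_set_at.
- by move=> w; rewrite mulr_ge0 ?sqr_ge0// mulr_ge0//; case/andP: p01' => *; rewrite ?subr_ge0.
Qed.

(** A root that is not removable has fewer than [j] unblocked children out of at least k >= j, so
    some child is blocked; then a union bound. *)
Lemma not_removable_le x n h (T := graph_ball N x n) (t := ball_tree (D x) n)
    (w : {ffun T -> bool}) : (0 < n)%N ->
  1 - (removable t j h (root t) w)%:R <=
  \sum_(z in kids t (root t)) (blocked t j h z w)%:R :> R.
Proof.
move=> n0; have [_|nr] := boolP (removable _ _ _ _ _).
  by rewrite subrr sumr_ge0// => z _; rewrite ler0n.
rewrite subr0; have [z zr bz] : exists2 z, z \in kids t (root t) & blocked t j h z w.
  apply/exists_inP; apply: contraNT nr => /exists_inPn nb.
  rewrite /removable (_ : [set _ in _ | _]%SET = kids t (root t)).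
    apply: (leq_trans jk); rewrite card_kidsE; last first.
      by rewrite -[vlev _ _]/(lev t (root t)) lev_root.
    by case/andP: (card_vkids (D x) (val (root t))).
  by apply/setP => z; rewrite finset.in_set; apply: andb_idr => /nb.
rewrite (bigD1 z)//= bz lerDl sumr_ge0// => y _; exact: ler0n.
Qed.

(* [v] is a bounded approximation of [u]: on the small event where [x] is not
   removable the energy of [v] is at most [M ^+ 2] times its probability. *)
Lemma flip_energy_le x u v A B (M d : R) h :
  local_on A u -> local_on B v -> (forall w, `|v w| <= M) -> 0 < d ->
  flip_energy x u <= removable_const p k.+1 h *
      (d * fine (sqnorm p u) + d^-1 * fine (sqnorm p (generator N j p u)))
    + 2 * M ^+ 2 * (k.+1%:R * blocked_prob j p k h)
    + 2 * fine (sqnorm p (fun w => u w - v w)).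
Proof.
move=> uA vB vM d0.
have [m1 H1] := sub_graph_ball x (nbhd A `|` B)%fset.
(* The ball is centred at [x] to make [x] its root; radius at least [h.+1] leaves [h] generations
   below the children of [x]. *)
pose n := maxn m1 h.+1; pose T := graph_ball N x n; pose t := ball_tree (D x) n.
have /fsubUsetP[AT BT] : (nbhd A `|` B `<=` T)%fset by apply: H1; exact: leq_maxl.
have uT : local_on T u.
  by apply: local_onS uA; apply: fsubset_trans AT; exact: sub_nbhd.
have vT : local_on T v by exact: local_onS vB.
have uvT : local_on T (fun w => u w - v w).
  exact: (@local_on_comp2 _ _ T (fun a b => a - b)).
rewrite (sqnorm_local p01' uT) (sqnorm_local p01' uvT) (sqnorm_generator uA AT) /=.
pose r : T := root t.
rewrite -[x]/(val r) (flip_energyE _ uT).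
set U := hat u; pose W : {ffun T -> bool} -> R := hat v.
pose g (w : {ffun T -> bool}) : R := (removable t j h r w)%:R.
have g01 w : 0 <= g w <= 1 by rewrite /g; case: removable; rewrite ?lexx ?ler01.
have -> : mean p (cond_var p [set r]%SET U) =
    mean p (fun w => g w * cond_var p [set r]%SET U w) +
    mean p (fun w => (1 - g w) * cond_var p [set r]%SET U w).
  by rewrite -meanD; apply: eq_mean => w; rewrite mulrBl mul1r addrC subrK.
rewrite -addrA; apply: lerD.
  apply: (le_trans (removable_bound p01 (@card_kids_le _ _ _ _ (D x) n)
    (@ball_rate01 _ N _ n j R) (@ball_rate_kids _ _ _ _ (D x) n j R) h r U)).
  rewrite ler_wpM2l ?removable_const_ge0//.
  (* The Dirichlet form is the mean of u (- L u), bounded by Young's inequality with the free weight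
     [d]. *)
  rewrite -(fin_dirichletE (D x)) -!meanZ -meanD; apply: (ler_mean p01') => w.
  set a := U w; set b := fin_generator _ _ _ _ _.
  have := sqr_ge0 (d * a + b); have dV : d * d^-1 = 1 by rewrite divff ?gt_eqF.
  move=> sq; rewrite -(ler_pM2l d0) mulrDr (mulrA d d^-1) dV mul1r.
  have := sqr_ge0 (d * a); have := sqr_ge0 b; nra.
have split2 : mean p (fun w => (1 - g w) * cond_var p [set r]%SET U w) <=
    2 * mean p (fun w => (1 - g w) * M ^+ 2) +
    2 * mean p (cond_var p [set r]%SET (fun w => U w - W w)).
  rewrite -!meanZ -meanD; apply: (ler_mean p01') => w.
  have := cond_varD_le p01' [set r]%SET U W w.
  have := cond_var_ge0 p01' [set r]%SET (fun w => U w - W w) w.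
  have : cond_var p [set r]%SET W w <= M ^+ 2.
    apply: (le_trans (cond_var_le _ _ _ _)).
    rewrite -[leRHS](@mean_cst _ p T); apply: (ler_mean p01') => w'.
    rewrite -real_normK ?num_real// lerXn2r ?nnegrE//; last exact: vM.
    exact: le_trans (normr_ge0 _) (vM (fun=> true)).
  have := cond_var_ge0 p01' [set r]%SET W w.
  have /andP[] := g01 w; set G := g w.
  set a := cond_var _ _ _ _; set b := cond_var _ _ _ _; set c := cond_var _ _ _ _.
  nra.
apply: (le_trans split2); apply: lerD.
  rewrite -mulrA ler_pM2l// meanZr mulrC ler_wpM2l ?sqr_ge0//.
  apply: (@le_trans _ _ (\sum_(z in kids t r) mean p (fun w => (blocked t j h z w)%:R))).
    rewrite -mean_sum; apply: (ler_mean p01') => w; apply: not_removable_le.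
    by rewrite (leq_trans _ (leq_maxr _ _)).
  rewrite (eq_bigr (fun=> blocked_prob j p k h)) => [|z zr]; last first.
    apply: mean_blocked => //; first exact: card_kids_inner.
      by rewrite (kids_lev zr).
    by rewrite (kids_lev zr) (lev_root t) add1n leq_maxr.
  rewrite sumr_const -[leLHS]mulr_natl ler_wpM2r//.
    by case/andP: (blocked_prob01 h p01' (leqW jk)).
  by rewrite ler_nat; exact: card_kids_le.
rewrite ler_pM2l//.
apply: (@le_trans _ _ (mean p (cond_mean p [set r]%SET (fun w => (U w - W w) ^+ 2)))).
  by apply: (ler_mean p01') => w; exact: cond_var_le.
by rewrite mean_cond_mean.
Qed.

(** Averaging over [B] turns [v] into a constant [a], and the average of [u] differs from [a] by
    that of u - v. Only flips in [B] are needed, which stays fixed while the support of [u] may grow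
    along a sequence. *)
Lemma sqnorm_center u v A B : local_on A u -> local_on B v ->
  exists a : R, fine (sqnorm p (fun w => u w - a)) <=
    2 * \sum_(x <- B) flip_energy x u + 2 * fine (sqnorm p (fun w => u w - v w)).
Proof.
move=> uA vB.
pose T := (A `|` B)%fset.
have uT : local_on T u by apply: local_onS uA; exact: fsubsetUl.
have vT : local_on T v by apply: local_onS vB; exact: fsubsetUr.
have uvT : local_on T (fun w => u w - v w).
  exact: (@local_on_comp2 _ _ T (fun a b => a - b)).
pose S := [set x : T | val x \in B]%SET.
have vS h : cond_mean p S (hat (T := T) v) h = mean p (hat (T := T) v).
  rewrite -(cond_mean_setT p _ h) -(finset.setUCr S) cond_meanU.
  apply: eq_cond_mean => h'; rewrite indep_cond_mean// => h1 h2.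
  apply: vB => x xB; have xT : x \in T by rewrite inE xB orbT.
  by rewrite -[x]/(val [` xT]%fset) !extend0_val ffunE !inE /= xB.
exists (mean p (hat (T := T) v)).
have uaT : local_on T (fun w => u w - mean p (hat (T := T) v)).
  exact: (@local_on_comp _ _ _ (fun y => y - mean p (hat (T := T) v))).
rewrite (sqnorm_local p01' uaT) (sqnorm_local p01' uvT) /=.
pose U : {ffun T -> bool} -> R := hat u; pose W : {ffun T -> bool} -> R := hat v.
set a := mean p (hat (T := T) v).
apply: (@le_trans _ _ (2 * mean p (fun h => (U h - cond_mean p S U h) ^+ 2) +
   2 * mean p (fun h => cond_mean p S (fun h => U h - W h) h ^+ 2))).
  rewrite -!meanZ -meanD; apply: (ler_mean p01') => h; rewrite cond_meanB vS -/a.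
  set b := cond_mean _ _ _ _.
  have -> : hat (fun w => u w - a) h = U h - a by [].
  have := sqr_ge0 (U h - b - (b - a)); lra.
rewrite -mean_cond_var//; apply: lerD; rewrite ler_pM2l//.
  have -> : S = (\bigcup_(x in S) [set x])%SET.
    apply/setP => x; apply/idP/finset.bigcupP => [xS|[y yS]].
      by exists x => //; exact/finset.set1P.
    by rewrite inE => /eqP ->.
  apply: (le_trans (mean_cond_var_bigU p01' _ _ _)).
  rewrite (eq_bigr (fun x => flip_energy (val x) u)) => [|x _]; last first.
    by rewrite flip_energyE.
  rewrite (eq_bigl (fun x : T => val x \in B)) => [|x]; last by rewrite inE.
  rewrite -(big_seq_fsetE _ T (fun x => x \in B) (flip_energy^~ u)) /= -big_filter.
  rewrite (perm_big B)//=; apply: uniq_perm; rewrite ?filter_uniq ?fset_uniq// => x.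
  by rewrite mem_filter !inE andb_idr// => ->; rewrite orbT.
rewrite -[leRHS](mean_cond_mean p S); apply: (ler_mean p01') => h.
exact: sqr_cond_mean_le.
Qed.

End energy.

Section sqnorm_limit.
Local Open Scope classical_set_scope.
Context (R : realType) (V : countType) (p : R) (p01 : 0 <= p <= 1).
Implicit Types (u v f : config V -> R) (A T : {fset V}).
Local Notation mu := (product_measure V p).

Lemma local_bounded A u : local_on A u -> exists M, forall w, `|u w| <= M.
Proof.
move=> uA; exists (\sum_(h : {ffun A -> bool}) `|hat u h|) => w.
rewrite -(hat_restr w uA) (bigD1 (restr A w))//= lerDl.
exact: sumr_ge0.
Qed.

Lemma sqnorm_fin A u : local_on A u -> sqnorm p u = (fine (sqnorm p u))%:E.
Proof. by move=> uA; rewrite (sqnorm_local p01 uA). Qed.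

Lemma sqnorm_ge0 u : (0 <= sqnorm p u)%E.
Proof. by apply: integral_ge0 => w _; rewrite lee_fin sqr_ge0. Qed.

Lemma sqnorm_cst (a : R) : sqnorm p (fun _ : config V => a) = (a ^+ 2)%:E.
Proof.
by rewrite /sqnorm integral_cst// [X in (_ * X)%E]probability_setT mule1.
Qed.

Lemma sqnormC u v : sqnorm p (fun w => u w - v w) = sqnorm p (fun w => v w - u w).
Proof. by apply: eq_integral => w _; rewrite -sqrrN opprB. Qed.

Lemma sqnorm0_ae f t : measurable_fun setT f ->
  sqnorm p (fun w => f w - t) = 0%E -> {ae mu, forall w, f w = t}.
Proof.
move=> mf f0.
have mg : measurable_fun setT (fun w => ((f w - t) ^+ 2)%:E).
  by apply/measurable_EFinP; apply: measurable_funX; exact: measurable_funB.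
have : (\int[mu]_w `|((f w - t) ^+ 2)%:E|)%E = 0%E.
  rewrite -f0; apply: eq_integral => w _.
  by rewrite gee0_abs// lee_fin sqr_ge0.
move/(ae_eq_integral_abs mu measurableT mg); apply: filterS => w /(_ I) /eqP.
by rewrite eqe sqrf_eq0 subr_eq0 => /eqP.
Qed.

(* The limit of the approximating constants is the supremum of the left ends of
   pairwise intersecting intervals around them. *)
Lemma sqnorm_approx_cst f : measurable_fun setT f ->
  (forall e : R, 0 < e -> exists a : R, (sqnorm p (fun w => f w - a)%R <= e%:E)%E) ->
  exists t : R, {ae mu, forall w, f w = t}.
Proof.
move=> mf fa.
(* The precision r^2 / 2 makes two such constants differ by at most r + s, their squared distance
   being at most r^2 + s^2. *)
have /choice[a aP] : forall r : {r : R | 0 < r}, exists a : R,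
    (sqnorm p (fun w => f w - a)%R <= (sval r ^+ 2 / 2)%:E)%E.
  by case=> r r0; apply: fa; rewrite divr_gt0// exprn_gt0.
have aa r s : a r - sval r <= a s + sval s.
  have [r0 s0] := (svalP r, svalP s).
  have : (sqnorm p (fun _ : config V => a r - a s)%R <= (sval r ^+ 2 + sval s ^+ 2)%:E)%E.
    have := @sqnormB _ _ p (cst (a r)) (cst (a s)) f.
    move=> /(_ (measurable_cst _) (measurable_cst _) mf) /le_trans; apply.
    rewrite /= ![sqnorm _ (fun w => _ - f w)]sqnormC.
    have -> : (sval r ^+ 2 + sval s ^+ 2)%:E =
        (2%:E * (sval r ^+ 2 / 2)%:E + 2%:E * (sval s ^+ 2 / 2)%:E)%E.
      by rewrite -!EFinM -EFinD; congr EFin; lra.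
    by apply: leeD; apply: lee_wpmul2l.
  rewrite sqnorm_cst lee_fin => H; rewrite leNgt; apply/negP => lt.
  have : sval r + sval s < a r - a s by lra.
  have : 0 < sval r + sval s by lra.
  nra.
pose E := [set a r - sval r | r in [set: {r : R | 0 < r}]].
pose one : {r : R | 0 < r} := exist _ 1 ltr01.
have E0 : E !=set0 by exists (a one - 1), one.
have Eub s : ubound E (a s + sval s) by move=> _ [r _ <-]; exact: aa.
exists (sup E); apply: sqnorm0_ae => //.
have dist r : (a r - sup E) ^+ 2 <= sval r ^+ 2.
  have h1 : a r - sval r <= sup E.
    by apply: ub_le_sup; [exists (a one + sval one) | exists r].
  have h2 : sup E <= a r + sval r by exact: sup_le_ub.
  have r0 := svalP r; nra.
apply/eqP; rewrite eq_le sqnorm_ge0 andbT; apply/lee_addgt0Pr => e e0.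
rewrite add0e.
have r0 : 0 < Num.sqrt (e / 3) by rewrite sqrtr_gt0 divr_gt0.
pose r : {r : R | 0 < r} := exist (fun r : R => 0 < r) _ r0.
have rE : sval r ^+ 2 = e / 3 by rewrite sqr_sqrtr// divr_ge0// ltW.
apply: (le_trans (@sqnormB _ _ p f (cst (sup E)) (cst (a r)) mf (measurable_cst _) (measurable_cst _))).
rewrite /= (_ : sqnorm _ (fun=> sup E - a r) = ((sup E - a r) ^+ 2)%:E); last exact: sqnorm_cst.
apply: (@le_trans _ _ (2%:E * (sval r ^+ 2 / 2)%:E + 2%:E * (sval r ^+ 2)%:E)%E).
  apply: leeD; apply: lee_wpmul2l => //; rewrite lee_fin.
  by rewrite -sqrrN opprB.
by rewrite rE -!EFinM -EFinD lee_fin; lra.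
Qed.

End sqnorm_limit.

(** * The kernel of the generator when blocking probabilities vanish *)

Section simple_zero.
Local Open Scope classical_set_scope.
Context (R : realType) (V : countType) (N : V -> {fset V}) (k j : nat).
Context (D : forall x, rooting N k x) (jk : (j <= k)%N).
Context (p : R) (p01 : 0 < p < 1).
Context (lam0 : forall e : R, 0 < e -> exists h, blocked_prob j p k h <= e).
Local Notation mu := (product_measure V p).

Let p01' : 0 <= p <= 1.
Proof. by case/andP: p01 => *; rewrite !ltW. Qed.

Section kernel.
Context (f : config V -> R) (u : nat -> config V -> R).
Context (mf : measurable_fun setT f) (uloc : forall n, local_fun (u n)).
Context (uf : cvg_L2 p u f).
Context (Lu : cvg_L2 p (fun n => generator N j p (u n)) (fun w => 0 * f w)).

Let mloc n : measurable_fun setT (u n).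
Proof. by have [A uA] := uloc n; exact: measurable_local uA. Qed.

Let q n m := fine (sqnorm p (fun w => u n w - u m w)).

Let localB n m : exists A, local_on A (fun w => u n w - u m w).
Proof.
have [A uA] := uloc n; have [B uB] := uloc m; exists (A `|` B)%fset.
apply: (@local_on_comp2 _ _ _ (fun a b => a - b)).
  by apply: local_onS uA; exact: fsubsetUl.
by apply: local_onS uB; exact: fsubsetUr.
Qed.

Let cauchy_q (e : R) : 0 < e -> exists n0, forall n m, (n0 <= n)%N -> (n0 <= m)%N -> q n m <= e.
Proof.
move=> e0; have e4 : 0 < e / 4 by rewrite divr_gt0.
have [n0 H] := cvg_L2P uf e4; exists n0 => n m /H Hn /H Hm.
have [A uA] := localB n m.
rewrite -lee_fin /q -(sqnorm_fin p01' uA).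
apply: (le_trans (sqnormB p (mloc n) (mloc m) mf)).
apply: (@le_trans _ _ (2%:E * (e / 4)%:E + 2%:E * (e / 4)%:E)%E).
  by apply: leeD; apply: lee_wpmul2l.
by rewrite -!EFinM -EFinD lee_fin; lra.
Qed.

Let bounded_q : exists2 B : R, 0 <= B & exists n0, forall n, (n0 <= n)%N -> fine (sqnorm p (u n)) <= B.
Proof.
have [n0 H] := cauchy_q ltr01.
exists (2 + 2 * fine (sqnorm p (u n0))).
  by rewrite addr_ge0// mulr_ge0// fine_ge0// sqnorm_ge0.
exists n0 => n n0n; have [A uA] := uloc n; have [B uB] := uloc n0.
have [C uC] := localB n n0.
rewrite -lee_fin -(sqnorm_fin p01' uA).
have := @sqnormD _ _ p (fun w => u n w - u n0 w) (u n0).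
rewrite (_ : sqnorm p (fun w => u n w - u n0 w + u n0 w) = sqnorm p (u n)); last first.
  by apply: eq_integral => w _; rewrite subrK.
move=> /(_ (measurable_funB (mloc n) (mloc n0)) (mloc n0)) /le_trans; apply.
rewrite [leRHS](_ : _ = (2%:E + 2%:E * (fine (sqnorm p (u n0)))%:E)%E); last first.
  by rewrite -EFinM -EFinD.
rewrite -(sqnorm_fin p01' uB); apply: leeD => //.
rewrite (sqnorm_fin p01' uC) -EFinM lee_fin.
have := H n n0 n0n (leqnn _); rewrite /q; lra.
Qed.

Let generator_q (e : R) : 0 < e -> exists n0, forall n, (n0 <= n)%N ->
  fine (sqnorm p (generator N j p (u n))) <= e.
Proof.
move=> e0; have [n0 H] := cvg_L2P Lu e0; exists n0 => n /H.
have [A uA] := uloc n.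
rewrite (_ : sqnorm p _ = sqnorm p (generator N j p (u n))); last first.
  by apply: eq_integral => w _; rewrite mul0r subr0.
by rewrite (sqnorm_fin p01' (local_generator j p uA)) lee_fin.
Qed.

Let flip_energy0 x (e : R) : 0 < e -> exists n0, forall n, (n0 <= n)%N ->
  flip_energy p x (u n) <= e.
Proof.
move=> e0; have e8 : 0 < e / 8 by rewrite divr_gt0.
(* The order of choices matters: [m] fixes the bounded approximation and its bound [M], then [h]
   depends on [M], [d] on the constant at depth [h], and [n] comes last. *)
have [m Hm] := cauchy_q e8.
have [B uB] := uloc m; have [M uM] := local_bounded uB.
have [Bd Bd0 [n1 Hn1]] := bounded_q.
have k0 : 0 < k.+1%:R :> R by rewrite ltr0n.
have M0 : 0 < M ^+ 2 + 1 by rewrite ltr_wpDl// sqr_ge0.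
have [h lamh] := lam0 (divr_gt0 e8 (mulr_gt0 M0 k0)).
set C := removable_const p k.+1 h.
have C0 : 0 <= C by exact: removable_const_ge0.
have C1 : 0 < C + 1 by lra.
have B1 : 0 < Bd + 1 by lra.
(* The error is split into four parts of size e / 4; adding 1 to [C] and [Bd] avoids dividing by
   zero. *)
pose d : R := e / 4 / ((C + 1) * (Bd + 1)).
have d0 : 0 < d by rewrite /d !divr_gt0// mulr_gt0.
have [n2 Hn2] : exists n0, forall n, (n0 <= n)%N ->
    fine (sqnorm p (generator N j p (u n))) <= e / 4 * d / (C + 1).
  by apply: generator_q; rewrite divr_gt0// mulr_gt0// divr_gt0.
exists (maxn m (maxn n1 n2)) => n; rewrite !geq_max => /and3P[mn n1n n2n].
have [A uA] := uloc n.
apply: (le_trans (flip_energy_le D jk p01 x h uA uB uM d0)).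
rewrite -/C -/(q n m).
have t1 : q n m <= e / 8 by apply: Hm.
have t2 : 2 * M ^+ 2 * (k.+1%:R * blocked_prob j p k h) <= e / 4.
  move: lamh; rewrite ler_pdivlMr ?mulr_gt0// => lamh.
  have l0 : 0 <= blocked_prob j p k h.
    by case/andP: (blocked_prob01 h p01' (leqW jk)).
  have : 0 <= k.+1%:R * blocked_prob j p k h by rewrite mulr_ge0// ltW.
  move: lamh; rewrite mulrA mulrAC [_ * k.+1%:R]mulrC.
  set L := k.+1%:R * _; nra.
have t3 : C * (d * fine (sqnorm p (u n))) <= e / 4.
  apply: (@le_trans _ _ ((C + 1) * (d * (Bd + 1)))).
    apply: ler_pM => //.
    - by rewrite mulr_ge0 ?(ltW d0)// fine_ge0// sqnorm_ge0.
    - by rewrite lerDl.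
    - by rewrite ler_pM2l//; have := Hn1 _ n1n; lra.
  rewrite le_eqVlt; apply/orP; left; apply/eqP; rewrite /d; field.
  by rewrite !gt_eqF.
have t4 : C * (d^-1 * fine (sqnorm p (generator N j p (u n)))) <= e / 4.
  apply: (@le_trans _ _ ((C + 1) * (d^-1 * (e / 4 * d / (C + 1))))).
    apply: ler_pM => //.
    - by rewrite mulr_ge0 ?invr_ge0 ?(ltW d0)// fine_ge0// sqnorm_ge0.
    - by rewrite lerDl.
    - by rewrite ler_pM2l ?invr_gt0//; exact: Hn2.
  rewrite le_eqVlt; apply/orP; left; apply/eqP; field.
  by rewrite !gt_eqF.
lra.
Qed.

Let flip_energy_sum0 (s : seq V) (e : R) : 0 < e -> exists n0, forall n, (n0 <= n)%N ->
  \sum_(x <- s) flip_energy p x (u n) <= e.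
Proof.
elim: s e => [|x s IH] e e0; first by exists 0%N => n _; rewrite big_nil ltW.
have e2 : 0 < e / 2 by rewrite divr_gt0.
have [n0 H0] := IH _ e2; have [n1 H1] := flip_energy0 x e2.
exists (maxn n0 n1) => n; rewrite geq_max => /andP[/H0 h0 /H1 h1].
by rewrite big_cons; lra.
Qed.

(** With [B] a fixed support of [u m], the energies of the flips in [B] vanish along the sequence,
    so [sqnorm_center] puts [u n], hence [f], close to a constant. *)
Lemma kernel_constant : exists t : R, {ae mu, forall w, f w = t}.
Proof.
apply: sqnorm_approx_cst => // e e0.
have e16 : 0 < e / 16 by rewrite divr_gt0.
have [m Hm] := cauchy_q e16.
have [B uB] := uloc m.
have [n0 H0] := flip_energy_sum0 B e16.
have [n1 H1] := cvg_L2P uf e16.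
pose n := maxn m (maxn n0 n1).
have [mn n0n n1n] : [/\ m <= n, n0 <= n & n1 <= n]%N by split; rewrite /n; lia.
have [A uA] := uloc n.
have [a Ha] := sqnorm_center p01 uA uB.
exists a.
have t1 : q n m <= e / 16 by apply: Hm.
have t2 := H0 _ n0n.
apply: (le_trans (@sqnormB _ _ p f (cst a) (u n) mf (measurable_cst _) (mloc n))).
rewrite sqnormC [X in (_ + _ * X)%E]sqnormC.
have uaA : local_on A (fun w => u n w - a).
  exact: (@local_on_comp _ _ _ (fun y => y - a)).
apply: (@le_trans _ _ (2%:E * (e / 16)%:E + 2%:E * (4 * (e / 16))%:E)%E).
  apply: leeD; apply: lee_wpmul2l => //; first exact: H1.
  rewrite [X in (X <= _)%E](sqnorm_fin p01' uaA) lee_fin.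
  move: Ha; rewrite -/(q n m); lra.
by rewrite -!EFinM -EFinD lee_fin; lra.
Qed.

End kernel.

Lemma generator_cst (a : R) (w : config V) : generator N j p (fun=> a) w = 0.
Proof.
rewrite /generator fsbig1// => x _.
by rewrite /site_mean -mulr_suml sum_bernoulli mul1r subrr mulr0.
Qed.

Lemma simple_eigenvalue0 : simple_eigenvalue N j p 0.
Proof.
exists (fun=> 1); split.
- have c0 : (fun w : config V => 0 * (fun=> 1) w) = cst (0 : R).
    by apply/funext => w; rewrite mul0r.
  rewrite c0; split; [exact: Lfun_cst | exact: Lfun_cst |].
  exists (fun _ _ => 1); first by move=> n; exists fset0.
  split; rewrite /cvg_L2.
    rewrite (_ : (fun n => _) = fun=> 0%E); first exact: cvg_cst.
    apply/funext => n; rewrite -[RHS](@Lnorm0 _ _ R mu 2%:E)//.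
    by congr Lnorm; apply/funext => w /=; rewrite subrr.
  rewrite (_ : (fun n => _) = fun=> 0%E); first exact: cvg_cst.
  apply/funext => n; rewrite -[RHS](@Lnorm0 _ _ R mu 2%:E)//.
  by congr Lnorm; apply/funext => w /=; rewrite generator_cst subrr.
- move=> [A [mA A0 AE]].
  have AT : A = setT.
    rewrite -subTset => w _; apply: AE => /= /eqP; by rewrite oner_eq0.
  by move: A0; rewrite AT probability_setT => /eqP; rewrite onee_eq0.
move=> f [Lf _ [u uloc [uf Lu]]].
have mf : measurable_fun setT f by have := sub_Lfun_mfun Lf; rewrite inE.
have [t ft] := kernel_constant mf uloc uf Lu; exists t.
by apply: filterS ft => w ->; rewrite mulr1.
Qed.

End simple_zero.

(** * The two trees *)

Section rooted_tree_rooting.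
Context (k : nat).

Lemma children_mem (x y : rooted_tree k) :
  (y \in children x) = (y != [::]) && (behead y == x).
Proof.
apply/imfsetP/andP => [[a _ ->]|[]] //=.
by case: y => //= a w _ /eqP ->; exists a.
Qed.

Lemma card_children (x : rooted_tree k) : #|` children x| = k.
Proof. by rewrite card_imfset ?size_enum_ord// => a b []. Qed.

Lemma upper_children (x : rooted_tree k) :
  [fset y in children x | (size x < size y)%N]%fset = children x.
Proof.
apply/fsetP => y; rewrite !inE; apply: andb_idr => /imfsetP[a _ ->] /=.
exact: ltnSn.
Qed.

Definition rooted_tree_rooting : rooting (@children k) k (@tree_root k).
Proof.
apply: (@Rooting _ _ _ _ (size : rooted_tree k -> nat) (behead : rooted_tree k -> rooted_tree k)).
- by move=> x; exact: size_eq0.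
- by move=> x; exact: size_behead.
- by move=> [//|a w] _; rewrite children_mem /= eqxx.
- by move=> x y /imfsetP[a _ ->]; left.
- by move=> x _; rewrite upper_children card_children.
- by rewrite upper_children card_children leqnn leqnSn.
Defined.

End rooted_tree_rooting.

Section regular_tree_rooting.
Context (k : nat).
Local Notation V := (regular_tree k).
Implicit Types (r s v : V).

Definition unit_word : V := Sub [::] (isT : reduced [::]).

Lemma reduced_rev (w : seq 'I_k.+1) : reduced w -> reduced (rev w).
Proof.
by rewrite /reduced rev_sorted; apply: sub_sorted => a b /=; rewrite eq_sym.
Qed.

Definition rev_word r : V := Sub (rev (val r)) (reduced_rev (valP r)).

(* In the free product of copies of Z/2, [translate s v] is the product of [v]
   by [s] on the right; translations commute with the generators, and the
   inverse of a word is the reversed word. *)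
Definition translate s v : V := foldr (fun a v => act v a) s (val v).

Lemma translate_act s v a : translate s (act v a) = act (translate s v) a.
Proof.
rewrite /translate /=; case: v => [[|b w] rw] //=.
by have [->|//] := eqVneq a b; rewrite actK.
Qed.

Lemma translate_comp s r v : translate s (translate r v) = translate (translate s r) v.
Proof. by rewrite {2}/translate [RHS]/translate; elim: (val v) => //= a w <-; rewrite translate_act. Qed.

Lemma translate1 v : translate unit_word v = v.
Proof.
apply: val_inj; rewrite /translate; case: v => /= w.
elim: w => //= a w IH rw.
have rw' : reduced w by case: w rw {IH} => //= b w /andP[].
rewrite IH//; case: w rw {IH rw'} => //= b w /andP[ab _].
by rewrite (negbTE ab).
Qed.

Lemma translate_rev r : translate (rev_word r) r = unit_word.
Proof.
rewrite /translate.
suff H (w : seq 'I_k.+1) : reduced w -> forall z : V, val z = rev w ->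
    foldr (fun a v => act v a) z w = unit_word.
  by apply: H => //; exact: valP.
elim/last_ind: w => [|w a IH] rw z; first by move=> z0; exact: val_inj.
rewrite rev_rcons foldr_rcons => za; apply: IH.
  by move: rw; rewrite /reduced -cats1 => /cat_sorted2[].
by rewrite /= za /= eqxx.
Qed.

Lemma rev_wordK r : rev_word (rev_word r) = r.
Proof. by apply: val_inj; rewrite /= revK. Qed.

(** The product of [v] by the inverse of [r]: an automorphism of the tree sending [r] to the empty
    word, so that its length is the distance from [r]. *)
Definition code r v : V := translate (rev_word r) v.

Lemma codeK r v : translate r (code r v) = v.
Proof.
by rewrite /code translate_comp -{1}(rev_wordK r) translate_rev translate1.
Qed.

Lemma code_act r v a : code r (act v a) = act (code r v) a.
Proof. exact: translate_act. Qed.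

Definition rlev r v := size (val (code r v)).

Definition rpar r v : V := if val (code r v) is a :: _ then act v a else v.

Lemma rlev_eq0 r v : (rlev r v == 0%N) = (v == r).
Proof.
apply/idP/eqP => [|->]; last by rewrite /rlev /code translate_rev.
rewrite /rlev size_eq0 => /eqP c0.
have {}c0 : code r v = unit_word by exact: val_inj.
by rewrite -(codeK r v) c0.
Qed.

Lemma rlev_act r v a : rlev r (act v a) =
  if val (code r v) is b :: w then if a == b then size w else (rlev r v).+1 else 1%N.
Proof.
rewrite /rlev code_act /=; case: (val (code r v)) => //= b w.
by case: eqP.
Qed.

Lemma rpar_act r v a : rlev r (act v a) = (rlev r v).+1 -> rpar r (act v a) = v.
Proof.
rewrite /rlev /rpar code_act /=; case: (val (code r v)) => /= [|b w].
  by rewrite actK.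
by case: eqP => [_|_ _]; [move=> /eqP; rewrite -addn2 -[X in X == _]addn0 eqn_add2l | rewrite actK].
Qed.

Lemma rlev_par r v : rlev r (rpar r v) = (rlev r v).-1.
Proof.
rewrite {1}/rpar; case E : (val (code r v)) => [|b w]; first by rewrite /rlev E.
by rewrite rlev_act E eqxx /rlev E.
Qed.

Lemma neighborsP v y : reflect (exists a, y = act v a) (y \in neighbors v).
Proof.
apply: (iffP idP) => [/imfsetP[a _ ->]|[a ->]]; first by exists a.
by apply/imfsetP; exists a.
Qed.

Lemma rpar_neighbor r v : (0 < rlev r v)%N -> rpar r v \in neighbors v.
Proof.
rewrite /rlev /rpar; case E : (val (code r v)) => [//|b w] _.
by apply/neighborsP; exists b.
Qed.

Lemma neighbors_lev r v y : y \in neighbors v ->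
  (rlev r y = (rlev r v).+1 /\ rpar r y = v) \/ ((0 < rlev r v)%N /\ y = rpar r v).
Proof.
move=> /neighborsP[a ->]; have E := rlev_act r v a; have F := @rpar_act r v a.
move: E F; rewrite /rlev /rpar; case C : (val (code r v)) => [|b w] /= E F.
  by left; split=> //; exact: F.
have [ab|ab] := eqVneq a b; first by right; rewrite ab.
by left; rewrite (negbTE ab) in E; split=> //; exact: F.
Qed.

Lemma upper_neighbors r v : (0 < rlev r v)%N ->
  [fset y in neighbors v | (rlev r v < rlev r y)%N]%fset = (neighbors v `\ rpar r v)%fset.
Proof.
move=> v0; apply/fsetP => y; rewrite !inE andbC.
have [yv|] := boolP (y \in neighbors v); last by rewrite !andbF.
rewrite !andbT; have [[E1 E2]|[_ ->]] := neighbors_lev r yv.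
  rewrite E1 ltnSn; apply/esym; apply/negP => /eqP E.
  by have := rlev_par r v; rewrite -E E1; lia.
by rewrite eqxx rlev_par ltnNge leq_pred.
Qed.

Definition regular_tree_rooting r : rooting (@neighbors k) k r.
Proof.
apply: (@Rooting _ _ _ _ (rlev r) (rpar r)).
- exact: rlev_eq0.
- exact: rlev_par.
- by move=> v /rpar_neighbor; rewrite neighbors_sym.
- by move=> v y; exact: neighbors_lev.
- move=> v v0; rewrite upper_neighbors//; have := card_neighbors v.
  by rewrite (cardfsD1 (rpar r v)) rpar_neighbor// add1n => -[].
- rewrite (_ : [fset _ in _ | _]%fset = neighbors r) ?card_neighbors ?leqnSn ?leqnn//.
  apply/fsetP => y; rewrite !inE; apply: andb_idr => /(neighbors_lev r) [[-> _]//|].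
  by rewrite (eqP (_ : rlev r r == 0%N)) ?rlev_eq0// => -[].
Defined.

End regular_tree_rooting.

(** * Main theorem *)

Lemma exp_decay_bound (R : realType) (eps A rho : R) : 0 < eps -> 0 < A -> 0 <= rho < 1 ->
  exists2 c : R, 0 < c & forall (n : nat) (g : R),
    g <= 1 - eps -> g <= A * rho ^+ n -> g <= expR (- (n.+1%:R / c)).
Proof.
move=> e0 A0 /andP[rho0 rho1].
(* [rho] may be 0, and a logarithm is taken. *)
pose s := Num.max rho 2^-1.
have s0 : 0 < s by rewrite lt_max invr_gt0 ltr0n orbT.
have s1 : s < 1 by rewrite gt_max rho1 invf_lt1// ltr1n.
pose a := - ln s.
have a0 : 0 < a by rewrite oppr_gt0 ln_lt0// s0.
pose L := `|ln (A / s)|.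
have L0 : 0 <= L by exact: normr_ge0.
(* The first summand handles large n, where half of the decay rate [a] absorbs the prefactor; the
   second gives (n + 1) / c <= eps when a (n + 1) < 2 L, and then 1 - eps <= exp(- eps) suffices. *)
pose c := 2 / a + 2 * L / (a * eps).
have c2a : 2 / a <= c by rewrite lerDl divr_ge0 ?mulr_ge0// ltW.
have c0 : 0 < c by apply: lt_le_trans c2a; rewrite divr_gt0.
exists c => // n g ge gA.
have n0 : 0 < n.+1%:R :> R by rewrite ltr0n.
have [big|small] := leP (2 * L) (a * n.+1%:R).
  apply: (le_trans gA); apply: (@le_trans _ _ (expR (L - a * n.+1%:R))).
    apply: (@le_trans _ _ (A / s * s ^+ n.+1)).
      rewrite exprS mulrA divfK ?gt_eqF// ler_pM2l//; apply: lerXn2r; rewrite ?nnegrE ?(ltW s0)//.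
      by rewrite le_max lexx.
    rewrite expRD -[X in X * _ <= _](lnK (x := A / s)) ?posrE ?divr_gt0//.
    rewrite -[X in _ * X <= _](lnK (x := s ^+ n.+1)) ?posrE ?exprn_gt0// lnXn// -[ln s *+ _]mulr_natr.
    rewrite /a mulNr opprK; apply: ler_pM; rewrite ?expR_ge0// ler_expR//.
    exact: ler_norm.
  rewrite ler_expR -subr_ge0.
  have : n.+1%:R / c <= n.+1%:R / (2 / a).
    by rewrite ler_pM2l// lef_pV2 ?posrE// divr_gt0.
  rewrite invf_div mulrA => H.
  have : n.+1%:R * a / 2 <= a * n.+1%:R - L by lra.
  lra.
apply: (le_trans ge); apply: (@le_trans _ _ (expR (- eps))); first exact: expR_ge1Dx.
rewrite ler_expR lerN2 ler_pdivrMr//.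
have : 2 * L / (a * eps) <= c by rewrite lerDr divr_ge0// ltW.
move=> H; have : eps * (2 * L / (a * eps)) <= eps * c by rewrite ler_pM2l.
apply: le_trans; rewrite [leRHS](_ : _ = 2 * L / a); last first.
  by field; rewrite !gt_eqF.
by rewrite ler_pdivlMr// mulrC ltW.
Qed.

Lemma critical_density_supercritical (R : realType) (V : countType)
    (N : V -> {fset V}) (k j : nat) (p : R) :
  (forall x, rooting N k x) -> (j <= k)%N ->
  critical_density R N j < p -> p < 1 ->
  0 < p /\ exists2 s : R, 0 <= s <= 1 & s < p * binom_cdf k j s.
Proof.
move=> D jk pc p1.
set S := [set p : R | 0 <= p < 1 /\ simple_eigenvalue N j p 0]%classic.
have Sub : has_ubound S by exists 1 => x [/andP[_ /ltW]].
have pc0 : 0 <= critical_density R N j.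
  (* The supremum of the empty set is 0, so the critical density is nonnegative in every case and
     [p] is positive. *)
  rewrite /critical_density -/S; have [->|/set0P[x Sx]] := eqVneq S set0.
    by rewrite sup0.
  by apply: le_trans (ub_le_sup Sub Sx); case: Sx => /andP[].
have p0 : 0 < p := le_lt_trans pc0 pc.
split=> //; apply: contrapT => nex.
have sub x : 0 <= x <= 1 -> p * binom_cdf k j x <= x.
  by move=> x01; rewrite leNgt; apply/negP => lt; apply: nex; exists x.
(* Without such an [s], 0 would be a simple eigenvalue at this density, which exceeds the
   supremum. *)
pose p' := (critical_density R N j + p) / 2.
have p'1 : critical_density R N j < p' by rewrite /p'; lra.
have p'p : p' < p by rewrite /p'; lra.
have p'0 : 0 < p' by exact: le_lt_trans p'1.
have p'lt1 : p' < 1 by exact: lt_trans p1.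
suff : S p' by move=> /(ub_le_sup Sub); rewrite leNgt p'1.
split; first by rewrite p'lt1 ltW.
apply: (simple_eigenvalue0 D jk); first by rewrite p'0.
move=> e e0.
have lamle := subcritical_blocked_prob (leqW jk) (introT andP (conj p'0 p'p)) (ltW p1) sub.
have r1 : `|p' / p| < 1.
  have r0 : 0 <= p' / p by rewrite divr_ge0// ltW.
  by rewrite ger0_norm// ltr_pdivrMr// mul1r.
have := cvgr_lt _ (cvg_expr r1) _ e0.
case=> h _ /(_ h (leqnn _)) /= lt; exists h.
by apply: le_trans (lamle h) _; exact: ltW.
Qed.

Theorem theorem3 (R : realType) (k j : nat) (p : R)
    (hk : (0 < k)%N) (hj : (0 < j)%N) (hjk : (j <= k)%N)
    (hp : critical_density R (@neighbors k) j < p) (hp1 : p < 1) :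
  exists2 c : R, 0 < c & forall n : nat,
    (forall r : regular_tree k,
       expR (- (c * n%:R)) <= gap (@neighbors k) j p (graph_ball (@neighbors k) r n)
         <= expR (- (n%:R / c))) /\
    (expR (- (c * n%:R)) <= gap (@children k) j p (graph_ball (@children k) (@tree_root k) n)
         <= expR (- (n%:R / c))).
Proof.
(* Since psi depends on [k] and [j] only, the [s] obtained from the unoriented model serves the
   oriented one too. *)
have [p0 [s s01 sp]] := critical_density_supercritical (@regular_tree_rooting k) hjk hp hp1.
have p01 : 0 < p < 1 by rewrite p0.
have [t [rho [t0 rho01 lamt lamrho]]] := supercritical_slope hj hjk p01 s01 sp.
pose C := block_const p k.+1.
have C1 : 1 < C by exact: block_const_gt1.
have C0 : 0 < C by exact: lt_trans C1.
have A0 : 0 < k.+1%:R / (p * t ^+ k.+1 * (1 - p)).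
  by rewrite divr_gt0 ?ltr0n// !mulr_gt0 ?exprn_gt0// subr_gt0.
have [c2 c20 decay] := exp_decay_bound (exprn_gt0 k.+1 p0) A0 rho01.
(* At least [ln C] for the lower bound and at least [c2] for the upper bound. *)
pose c := ln C + c2.
have lnC : 0 < ln C by rewrite ln_gt0.
have c0 : 0 < c by rewrite addr_gt0.
suff main (V : countType) (N : V -> {fset V}) r (D : rooting N k r) n :
    expR (- (c * n%:R)) <= gap N j p (graph_ball N r n) <= expR (- (n%:R / c)).
  exists c => // n; split=> [r|]; first exact: main (regular_tree_rooting r) n.
  exact: main (rooted_tree_rooting k) n.
apply/andP; split.
  apply: le_trans (ball_gap_ge D n hjk p01).
  rewrite expRN lef_pV2 ?posrE ?expR_gt0 ?exprn_gt0//.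
  rewrite -[leLHS]lnK ?posrE ?exprn_gt0// ler_expR lnXn// -[ln C *+ _]mulr_natr ler_wpM2r//.
  by rewrite lerDl ltW.
(* At radius 0 the upper bound is 1; a ball of radius n + 1 yields only the power n of [rho], whence
   the shift in [exp_decay_bound]. *)
case: n => [|n]; first by rewrite mul0r oppr0 expR0 (ball_gap_le1 D 0 j p01).
apply: (@le_trans _ _ (expR (- (n.+1%:R / c2)))); last first.
  by rewrite ler_expR lerN2 ler_pM2l ?ltr0n// lef_pV2 ?posrE// lerDr ltW.
apply: decay; first exact: (ball_gap_le_spin D p01 hj).
apply: (le_trans (ball_gap_le_blocked D hjk p01 hj erefl t0 lamrho lamt)).
by rewrite mulrAC.
Qed.
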